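(* For every $n\ge 5$ there exist unbounded homogeneous domains $\Omega_1,\Omega_2\subset\mathbb{C}^n$ which are not biholomorphically equivalent, while their automorphism groups $\mathrm{Aut}(\Omega_1)$ and $\mathrm{Aut}(\Omega_2)$ are isomorphic.
   Context: A domain $\Omega$ is homogeneous if its group $\mathrm{Aut}(\Omega)$ of biholomorphic self-maps acts transitively on $\Omega$. *)

(* Defs.v *)
From HB Require Import structures.
From mathcomp Require Import all_boot all_order all_algebra.
From mathcomp Require Import all_classical all_reals all_analysis.
From mathcomp Require Import complex.
Import Order.TTheory GRing.Theory Num.Theory.
Import numFieldNormedType.Exports.
Local Open Scope ring_scope.
Local Open Scope classical_set_scope.
Set Implicit Arguments.
Unset Strict Implicit.

(* C^n is modelled as row vectors 'rV[R[i]]_n over the complex numbers R[i]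
   built on an arbitrary real field R : realType, with the normed-module
   structure (sup norm) provided by mathcomp-analysis on matrices over a
   numFieldType. *)
Definition Cn (R : realType) (n : nat) : normedModType R[i] :=
  [the normedModType R[i] of 'rV[R[i]]_n].

Definition is_domain (R : realType) (n : nat) (D : set (Cn R n)) : Prop :=
  D !=set0 /\ open D /\ connected D.

(* f is holomorphic on the open set D: complex (Frechet, R[i]-linear)
   differentiable at every point of D. *)
Definition holomorphic_on (R : realType) (n : nat) (D : set (Cn R n))
  (f : Cn R n -> Cn R n) : Prop :=
  forall z, D z -> differentiable f z.

Definition biholo_pair (R : realType) (n : nat) (D1 D2 : set (Cn R n))
  (f g : Cn R n -> Cn R n) : Prop :=
  [/\ holomorphic_on D1 f, holomorphic_on D2 g,
      f @` D1 `<=` D2, g @` D2 `<=` D1 &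
      (forall z, D1 z -> g (f z) = z) /\
      (forall w, D2 w -> f (g w) = w)].

Definition biholomorphic (R : realType) (n : nat) (D1 D2 : set (Cn R n)) : Prop :=
  exists f g, biholo_pair D1 D2 f g.

Definition is_aut (R : realType) (n : nat) (D : set (Cn R n))
  (f : Cn R n -> Cn R n) : Prop :=
  exists g, biholo_pair D D f g.

Definition homogeneous (R : realType) (n : nat) (D : set (Cn R n)) : Prop :=
  forall z w, D z -> D w -> exists f, is_aut D f /\ f z = w.

(* Two maps define the same element of Aut(D) iff they agree on D. *)
Definition eq_on (R : realType) (n : nat) (D : set (Cn R n))
  (f g : Cn R n -> Cn R n) : Prop :=
  forall z, D z -> f z = g z.

(* Aut(D1) and Aut(D2) are isomorphic as (abstract) groups: there is a map
   phi sending automorphisms of D1 to automorphisms of D2, compatible with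
   the identification of maps agreeing on the domain, which is a
   homomorphism for composition, injective and surjective. *)
Definition aut_isomorphic (R : realType) (n : nat) (D1 D2 : set (Cn R n)) : Prop :=
  exists phi : (Cn R n -> Cn R n) -> (Cn R n -> Cn R n),
  [/\ (forall f, is_aut D1 f -> is_aut D2 (phi f)),
      (forall f g, is_aut D1 f -> is_aut D1 g ->
         (eq_on D2 (phi f) (phi g) <-> eq_on D1 f g)),
      (forall f g, is_aut D1 f -> is_aut D1 g ->
         eq_on D2 (phi (f \o g)) (phi f \o phi g)) &
      (forall h, is_aut D2 h -> exists2 f, is_aut D1 f & eq_on D2 (phi f) h)].

(* Main.v *)
(* For a set S of coordinates let Om S = {sum_(k in S) |v_k|^2 > sum_(k notin S) |v_k|^2}.
   The two domains are Om S and Om S' for complementary S, S' with at least two elements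
   and #|S| <> #|S'|. Since S contains two indices, every holomorphic function on Om S
   extends to C^n: Cauchy's integral in one of the variables gives an entire function, and
   the remaining Laurent part vanishes by letting a second variable be large. Hence every
   automorphism of Om S is the restriction of an automorphism of C^n which preserves Om S,
   and therefore also the interior Om S' of the complement: both groups are the stabilizer
   of Om S in Aut(C^n). A biholomorphism from Om S to Om S' extends to an automorphism F of
   C^n; first-order considerations at 0 give F(0) = 0, so that dF(0) maps the span of the
   S-coordinates injectively into the closed cone of Om S', whence #|S| <= #|S'|.
   Transitivity follows from complex reflections of the Hermitian form and scalings. *)
Require Import Defs.
From HB Require Import structures.
From mathcomp Require Import all_boot all_order all_algebra.
From mathcomp Require Import all_classical all_reals all_analysis.
From mathcomp Require Import complex ring lra.
Import Order.TTheory GRing.Theory Num.Theory.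
Import numFieldNormedType.Exports.
Local Open Scope ring_scope.
Local Open Scope classical_set_scope.
Local Open Scope complex_scope.
Set Implicit Arguments.
Unset Strict Implicit.

(** Holomorphic means complex differentiable at each point, with no continuity of the differential.
    Hence the analysis starts from Goursat's bisection, and differentiation under an integral rests
    on a quadratic remainder controlled by a bound on the function alone ([second_order_vec]). All
    contour integrals are means over circles centred at 0: that [mean r h] does not depend on [r]
    across an annulus is the one fact behind Cauchy's formula, the Laurent splitting and the
    uniqueness of extensions, with neither power series nor an identity theorem. Parameters are
    whole vectors of C^n, so the extension is differentiable in all variables jointly. The bound
    [n >= 5] is arithmetic: both index sets need two elements, and [n = 4] would leave only the
    sizes 2 and 2. In the comparison of cardinals, strict positivity is lost when passing to the
    differential. The closed cone suffices, because a vector of it whose coordinates in the index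
    set all vanish is 0. *)

(* An opaque-headed alias of [R[i]]: canonical inference finds the topological and
   normed-module structures of a [numFieldType] on it, but not on [R[i]]. *)
Definition CC (R : realType) : numFieldType := [the numFieldType of R[i]].
Definition rc (R : realType) (x : R) : CC R := x%:C.
Definition cRe (R : realType) (z : CC R) : R := complex.Re z.
Definition cIm (R : realType) (z : CC R) : R := complex.Im z.
(* Norms over [R[i]] take values in [R[i]]; [rn] is the same norm, valued in [R]. *)
Definition rn (R : realType) (V : normedModType (CC R)) (v : V) : R :=
  cRe `|v|.
Definition ic (R : realType) : CC R := 'i%C.

(** * Real-valued norms, and differentiability in terms of them *)

Section RealNorm.
Variable R : realType.
Local Notation C := (CC R).

Lemma rcD x y : rc (x + y) = rc x + rc y :> C.
Proof. exact: (rmorphD (real_complex R)). Qed.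
Lemma rcN x : rc (- x) = - rc x :> C.
Proof. exact: (rmorphN (real_complex R)). Qed.
Lemma rcB x y : rc (x - y) = rc x - rc y :> C.
Proof. by rewrite rcD rcN. Qed.
Lemma rcM x y : rc (x * y) = rc x * rc y :> C.
Proof. exact: (rmorphM (real_complex R)). Qed.
Lemma rc0 : rc 0 = 0 :> C. Proof. by []. Qed.
Lemma rc1 : rc 1 = 1 :> C. Proof. by []. Qed.
Lemma rcV x : rc x^-1 = (rc x)^-1 :> C.
Proof. exact: (fmorphV (real_complex R)). Qed.
Lemma rc_inj (x y : R) : rc x = rc y -> x = y.
Proof. exact: complexI. Qed.
Lemma rc_eq0 x : (rc x == 0 :> C) = (x == 0).
Proof. exact: (fmorph_eq0 (real_complex R)). Qed.
Lemma rc_lt x y : (rc x < rc y :> C) = (x < y). Proof. exact: ltcR. Qed.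
Lemma rc_le x y : (rc x <= rc y :> C) = (x <= y). Proof. exact: lecR. Qed.

Lemma gt0_rc (e : C) : 0 < e -> exists2 x : R, 0 < x & e = rc x.
Proof.
rewrite ltcE => /andP[/eqP i r]; exists (cRe e) => //.
by case: e i r => a b /= -> _.
Qed.

Lemma cReD (z w : C) : cRe (z + w) = cRe z + cRe w.
Proof. by case: z; case: w. Qed.
Lemma cImD (z w : C) : cIm (z + w) = cIm z + cIm w.
Proof. by case: z; case: w. Qed.
Lemma cReN (z : C) : cRe (- z) = - cRe z.
Proof. by case: z. Qed.
Lemma cImN (z : C) : cIm (- z) = - cIm z.
Proof. by case: z. Qed.
Lemma cReM (z w : C) : cRe (z * w) =
  cRe z * cRe w - cIm z * cIm w.
Proof. by case: z; case: w. Qed.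
Lemma cImM (z w : C) : cIm (z * w) =
  cRe z * cIm w + cIm z * cRe w.
Proof. by case: z => a b; case: w => c d /=. Qed.
Lemma CCE (z : C) : z = rc (cRe z) + ic R * rc (cIm z).
Proof. exact: complexE. Qed.
Lemma Cext (z w : C) : cRe z = cRe w ->
  cIm z = cIm w -> z = w.
Proof. by case: z => a b; case: w => c d /= -> ->. Qed.

Section V.
Variable V : normedModType C.
Implicit Types v w : V.

Lemma normE v : `|v| = rc (rn v).
Proof.
apply: Cext => //=.
by rewrite /cIm /=; have := normr_ge0 v; rewrite lecE => /andP[/eqP -> _].
Qed.

Lemma rn_ge0 v : 0 <= rn v.
Proof. by rewrite -rc_le -normE rc0 normr_ge0. Qed.
Lemma rnD v w : rn (v + w) <= rn v + rn w.
Proof. by rewrite -rc_le rcD -!normE ler_normD. Qed.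
Lemma rnN v : rn (- v) = rn v.
Proof. by rewrite /rn normrN. Qed.
Lemma rn_distC v w : rn (v - w) = rn (w - v).
Proof. by rewrite /rn distrC. Qed.
Lemma rnB v w : rn (v - w) <= rn v + rn w.
Proof. by rewrite -(rnN w) rnD. Qed.
Lemma rn0 : rn (0 : V) = 0.
Proof. by rewrite /rn normr0. Qed.
Lemma rn_eq0 v : (rn v == 0) = (v == 0).
Proof. by rewrite -rc_eq0 -normE normr_eq0. Qed.
Lemma rn_gt0 v : (0 < rn v) = (v != 0).
Proof. by rewrite lt_neqAle rn_ge0 andbT eq_sym rn_eq0. Qed.
Lemma rnZ (a : C) v : rn (a *: v) = rn (a : C) * rn v.
Proof. by apply: rc_inj; rewrite rcM -!normE normrZ normE. Qed.
Lemma rn_distD w v u : rn (v - u) <= rn (v - w) + rn (w - u).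
Proof. by rewrite -rc_le rcD -!normE ler_distD. Qed.
Lemma rn_sub v w : rn v - rn w <= rn (v - w).
Proof. by rewrite lerBlDr -{1}(subrK w v) rnD. Qed.

Lemma nbhs_rnP v (A : set V) :
  nbhs v A <-> exists2 d : R, 0 < d & forall w, rn (w - v) < d -> A w.
Proof.
split.
  move/nbhs_ballP => [e /= /gt0_rc[d d0 ->] H]; exists d => // w wd.
  by apply: H; rewrite -ball_normE /ball_ /= normE rc_lt rn_distC.
move=> [d d0 H]; apply/nbhs_ballP; exists (rc d) => /=; first by rewrite rc_lt.
by move=> w; rewrite -ball_normE /ball_ /= normE rc_lt rn_distC; exact: H.
Qed.

Lemma cvg_rnP T (F : set_system T) (FF : Filter F) (f : T -> V) l :
  f x @[x --> F] --> l <->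
  forall e : R, 0 < e -> \forall x \near F, rn (f x - l) < e.
Proof.
split=> [/cvgrPdist_lt H e e0|H].
  have := H (rc e); rewrite rc_lt => /(_ e0).
  by apply: filterS => x; rewrite normE rc_lt rn_distC.
apply/cvgrPdist_lt => _ /gt0_rc[d d0 ->].
by apply: filterS (H d d0) => x; rewrite normE rc_lt rn_distC.
Qed.

End V.

Lemma rnM (a b : C) : rn (a * b) = rn a * rn b.
Proof. by apply: rc_inj; rewrite rcM -!normE normrM. Qed.
Lemma rn1 : rn (1 : C) = 1.
Proof. by rewrite /rn normr1. Qed.
Lemma rnX (a : C) k : rn (a ^+ k) = rn a ^+ k.
Proof. by elim: k => [|k IH]; rewrite ?expr0 ?rn1 // !exprS rnM IH. Qed.
Lemma rnV (a : C) : rn a^-1 = (rn a)^-1.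
Proof. by apply: rc_inj; rewrite rcV -!normE normfV. Qed.
Lemma rn_rc (x : R) : rn (rc x) = `|x|.
Proof. by rewrite /rn /rc normc_def /= expr0n /= addr0 sqrtr_sqr. Qed.
Lemma rn_sqr (z : C) : rn z ^+ 2 = cRe z ^+ 2 + cIm z ^+ 2.
Proof.
by rewrite /rn normc_def /= sqr_sqrtr // addr_ge0 ?sqr_ge0.
Qed.
Lemma rnE (z : C) : rn z = Num.sqrt (cRe z ^+ 2 + cIm z ^+ 2).
Proof. by rewrite /rn normc_def. Qed.
Lemma Re_le_rn (z : C) : `|cRe z| <= rn z.
Proof. by rewrite rnE -sqrtr_sqr ler_wsqrtr // lerDl sqr_ge0. Qed.
Lemma Im_le_rn (z : C) : `|cIm z| <= rn z.
Proof. by rewrite rnE -sqrtr_sqr ler_wsqrtr // lerDr sqr_ge0. Qed.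
Lemma rn_ic : rn (ic R) = 1.
Proof. by rewrite rnE /= expr0n /= add0r expr1n sqrtr1. Qed.
Lemma rn_le_ReIm (z : C) : rn z <= `|cRe z| + `|cIm z|.
Proof.
rewrite {1}(CCE z); apply: (le_trans (rnD _ _)).
by rewrite rnM rn_ic mul1r !rn_rc.
Qed.

Lemma continuous_rn (V : normedModType C) : continuous (@rn R V).
Proof.
move=> v; apply/cvgrPdist_lt => e e0; apply/nbhs_rnP; exists e => // w we.
apply: le_lt_trans we; rewrite ler_norml; apply/andP; split.
  by rewrite lerNl opprB rn_sub.
by rewrite rn_distC rn_sub.
Qed.
Lemma continuous_Re : continuous (@cRe R).
Proof.
move=> v; apply/(@cvgrPdist_lt _ _ _ _ (nbhs_filter v)) => e e0; apply/nbhs_rnP;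
  exists e => // w we.
apply: le_lt_trans we; rewrite distrC -cReN -cReD; exact: Re_le_rn.
Qed.
Lemma continuous_Im : continuous (@cIm R).
Proof.
move=> v; apply/(@cvgrPdist_lt _ _ _ _ (nbhs_filter v)) => e e0; apply/nbhs_rnP;
  exists e => // w we.
apply: le_lt_trans we; rewrite distrC -cImN -cImD; exact: Im_le_rn.
Qed.
Lemma continuous_rc : continuous (@rc R).
Proof.
move=> v; apply/(@cvg_rnP _ _ _ (nbhs_filter v)) => e e0; apply/nbhs_ballP; exists e => // w.
by rewrite -ball_normE /= -rcB rn_rc distrC.
Qed.

Section Diff.
Variables V W : normedModType C.
Implicit Types f : V -> W.

Lemma diff_rnP f v : differentiable f v -> forall e : R, 0 < e ->
  exists2 d : R, 0 < d & forall k, rn k < d ->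
    rn (f (k + v) - f v - 'd f v k) <= e * rn k.
Proof.
move=> /diff_locallyP [_ /eqaddoP H] e e0.
have := H (rc e); rewrite rc_lt => /(_ e0) /nbhs_rnP [d d0 K].
exists d => // k; rewrite -{1}(subr0 k) => /K.
by rewrite !fctE !normE -rcM rc_le opprD addrA.
Qed.

(** The bound [M] makes [L] continuous, as is required of a differential between normed modules of
    arbitrary dimension; uniqueness of the differential then identifies [L]. *)
Lemma rnP_diff f v (L : {linear V -> W}) (M : R) :
  (forall k, rn (L k) <= M * rn k) ->
  (forall e : R, 0 < e -> exists2 d : R, 0 < d & forall k, rn k < d ->
    rn (f (k + v) - f v - L k) <= e * rn k) -> differentiable f v.
Proof.
move=> LM H.
have Lc : continuous L.
  apply: bounded_linear_continuous.
  apply/linear_boundedP; near=> r => k.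
  rewrite !normE; apply: le_trans (_ : rc M * rc (rn k) <= _).
    by rewrite -rcM rc_le LM.
  by apply: ler_wpM2r; [rewrite rc_le rn_ge0|near: r; apply: nbhs_pinfty_ge;
    rewrite complex_real].
suff E : f \o shift v = cst (f v) + L +o_ (0 : V) id.
  apply/diff_locallyP.
  have -> : 'd f v = L :> (V -> W) by exact: diff_unique.
  by split.
apply/eqaddoP => _ /gt0_rc[e e0 ->].
have [d d0 K] := H e e0.
apply/nbhs_rnP; exists d => // k; rewrite subr0 => /K.
by rewrite -rc_le rcM -!normE /= !fctE opprD addrA.
Unshelve. all: by end_near. Qed.

End Diff.
End RealNorm.

(** * Integrals of complex-valued functions *)

Definition cint (R : realType) (g : R -> CC R) (a b : R) : CC R :=
  rc (\int[lebesgue_measure]_(x in `[a, b]) cRe (g x)) +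
  ic R * rc (\int[lebesgue_measure]_(x in `[a, b]) cIm (g x)).

(* Two-sided continuity, also at the end points. *)
Definition cts_on (R : realType) (a b : R) (g : R -> CC R) : Prop :=
  forall x, a <= x <= b -> {for x, continuous g}.

Section Integral.
Variable R : realType.
Local Notation C := (CC R).
Local Notation mu := (@lebesgue_measure R).
Implicit Types (g h : R -> C) (a b c : R).

Lemma cts_onD a b g h : cts_on a b g -> cts_on a b h ->
  cts_on a b (fun x => g x + h x).
Proof. by move=> G H x ab; apply: continuousD; [exact: G|exact: H]. Qed.
Lemma cts_onN a b g : cts_on a b g -> cts_on a b (fun x => - g x).
Proof. by move=> G x ab; apply: continuousN; exact: G. Qed.
Lemma cts_onB a b g h : cts_on a b g -> cts_on a b h ->
  cts_on a b (fun x => g x - h x).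
Proof. by move=> G H; exact: (cts_onD G (cts_onN H)). Qed.
Lemma cts_onM a b g h : cts_on a b g -> cts_on a b h ->
  cts_on a b (fun x => g x * h x).
Proof. by move=> G H x ab; apply: continuousM; [exact: G|exact: H]. Qed.
Lemma cts_on_cst a b (k : C) : cts_on a b (fun=> k).
Proof. by move=> x _; exact: cst_continuous. Qed.

Lemma Re_integrable a b g : cts_on a b g ->
  mu.-integrable `[a, b] (EFin \o (fun x => cRe (g x))).
Proof.
move=> G; apply: continuous_compact_integrable; first exact: segment_compact.
apply: continuous_in_subspaceT => x; rewrite inE /= in_itv /= => xab.
apply: (@continuous_comp _ _ _ g (@cRe R)); first exact: G.
exact: continuous_Re.
Qed.

Lemma Im_integrable a b g : cts_on a b g ->
  mu.-integrable `[a, b] (EFin \o (fun x => cIm (g x))).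
Proof.
move=> G; apply: continuous_compact_integrable; first exact: segment_compact.
apply: continuous_in_subspaceT => x; rewrite inE /= in_itv /= => xab.
apply: (@continuous_comp _ _ _ g (@cIm R)); first exact: G.
exact: continuous_Im.
Qed.

Lemma Re_cint g a b : cRe (cint g a b) =
  \int[mu]_(x in `[a, b]) cRe (g x).
Proof. by rewrite /cint cReD cReM /= mul0r mul1r oppr0 !addr0. Qed.
Lemma Im_cint g a b : cIm (cint g a b) =
  \int[mu]_(x in `[a, b]) cIm (g x).
Proof. by rewrite /cint cImD cImM /= mul0r mul1r !add0r. Qed.

Lemma eq_cint a b g h : (forall x, a <= x <= b -> g x = h x) ->
  cint g a b = cint h a b.
Proof.
by move=> E; rewrite /cint; congr (rc _ + _ * rc _);
  apply: eq_Rintegral => x; rewrite inE /= in_itv /= => /E ->.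
Qed.

Lemma cintD a b g h : cts_on a b g -> cts_on a b h ->
  cint (fun x => g x + h x) a b = cint g a b + cint h a b.
Proof.
move=> G H; apply: Cext.
- rewrite cReD !Re_cint -RintegralD //; try exact: Re_integrable.
  by apply: eq_Rintegral => x _; rewrite cReD.
- rewrite cImD !Im_cint -RintegralD //; try exact: Im_integrable.
  by apply: eq_Rintegral => x _; rewrite cImD.
Qed.

Lemma integrable_scale a b (k : R) (u : R -> R) :
  mu.-integrable `[a, b] (EFin \o u) ->
  mu.-integrable `[a, b] (EFin \o (fun x => k * u x)).
Proof.
move=> U.
have -> : EFin \o (fun x => k * u x) = (fun x => k%:E * (EFin \o u) x)%E.
  by apply/funext => x /=; rewrite EFinM.
exact: integrableZl.
Qed.

Lemma cintZ a b (k : C) g : cts_on a b g ->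
  cint (fun x => k * g x) a b = k * cint g a b.
Proof.
move=> G; have rG := Re_integrable G; have iG := Im_integrable G.
apply: Cext.
- rewrite cReM !Re_cint !Im_cint -!RintegralZl // -RintegralB //.
  + by apply: eq_Rintegral => x _; rewrite cReM.
  + exact: integrable_scale.
  + exact: integrable_scale.
- rewrite cImM !Re_cint !Im_cint -!RintegralZl // -RintegralD //.
  + by apply: eq_Rintegral => x _; rewrite cImM.
  + exact: integrable_scale.
  + exact: integrable_scale.
Qed.

Lemma cintN a b g : cts_on a b g ->
  cint (fun x => - g x) a b = - cint g a b.
Proof.
move=> G; rewrite -mulN1r -cintZ //; apply: eq_cint => x _.
by rewrite mulN1r.
Qed.

Lemma cintB a b g h : cts_on a b g -> cts_on a b h ->
  cint (fun x => g x - h x) a b = cint g a b - cint h a b.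
Proof. by move=> G H; rewrite -(cintN H) -(cintD G (cts_onN H)). Qed.

Lemma Rint_cst a b M : a <= b -> \int[mu]_(x in `[a, b]) M = M * (b - a).
Proof.
move=> ab; rewrite Rintegral_cst //; congr (_ * _).
rewrite (_ : fine _ = fine (lebesgue_measure (`[a, b]%classic : set R))) //.
rewrite lebesgue_measure_itv /= lte_fin.
by case: ltgtP ab => // -> _; rewrite subrr.
Qed.

Lemma cint_cst a b (k : C) : a <= b -> cint (fun=> k) a b = rc (b - a) * k.
Proof.
move=> ab; apply: Cext.
- by rewrite Re_cint Rint_cst // cReM /= mul0r subr0 mulrC.
- by rewrite Im_cint Rint_cst // cImM /= mul0r addr0 mulrC.
Qed.

Lemma Rint_bound a b (u : R -> R) M : a <= b ->
  mu.-integrable `[a, b] (EFin \o u) ->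
  (forall x, a <= x <= b -> `|u x| <= M) ->
  `|\int[mu]_(x in `[a, b]) u x| <= M * (b - a).
Proof.
move=> ab U H; apply: le_trans (le_normr_Rintegral _ U) _ => //.
rewrite -(Rint_cst M ab).
apply: le_Rintegral => //.
- exact: integrable_norm.
- apply: continuous_compact_integrable; first exact: segment_compact.
  by apply: continuous_subspaceT => x; exact: cst_continuous.
Qed.

(** The factor 2 comes from bounding real and imaginary parts separately; all later estimates
    tolerate it. *)
Lemma cint_bound a b g M : a <= b -> cts_on a b g ->
  (forall x, a <= x <= b -> rn (g x) <= M) -> rn (cint g a b) <= 2 * M * (b - a).
Proof.
move=> ab G H; apply: le_trans (rn_le_ReIm _) _.
rewrite Re_cint Im_cint -mulrA mulr_natl mulr2n lerD //.
- apply: Rint_bound => //; first exact: Re_integrable.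
  by move=> x /H; apply: le_trans; exact: Re_le_rn.
- apply: Rint_bound => //; first exact: Im_integrable.
  by move=> x /H; apply: le_trans; exact: Im_le_rn.
Qed.

Lemma cint_cat a c b g : a <= c <= b -> cts_on a b g ->
  cint g a b = cint g a c + cint g c b.
Proof.
move=> /andP[ac cb] G.
have E (u : R -> R) : mu.-integrable `[a, b] (EFin \o u) ->
    \int[mu]_(x in `[a, b]) u x =
    \int[mu]_(x in `[a, c]) u x + \int[mu]_(x in `[c, b]) u x.
  move=> U; rewrite -(@Rintegral_itv_obnd_cbnd R c).
    by rewrite -(Rintegral_itvB U) ?bnd_simp // addrC subrK.
  by apply: integrableS U => //; apply: subset_itvr; rewrite bnd_simp.
apply: Cext.
- by rewrite cReD !Re_cint; apply: E; exact: Re_integrable.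
- by rewrite cImD !Im_cint; apply: E; exact: Im_integrable.
Qed.

End Integral.

(** * Goursat's theorem on rectangles *)

Definition pt (R : realType) (x y : R) : CC R := rc x + ic R * rc y.

(* The integral of [G] along the boundary of a rectangle; horizontal and vertical
   sides are paired, so that the integrand of an affine [G] is constant. *)
Definition rect (R : realType) (G : CC R -> CC R) (a b c d : R) : CC R :=
  cint (fun x => G (pt x c) - G (pt x d)) a b +
  ic R * cint (fun y => G (pt b y) - G (pt a y)) c d.

Section Goursat.
Variable R : realType.
Local Notation C := (CC R).
Implicit Types G : C -> C.

(** [s n] is the left end of the [n]-th interval, of length [w / 2 ^+ n]. The right ends decrease,
    so the supremum of the left ends lies in every interval. *)
Lemma nested_monotone (w : R) (s : nat -> R) : 0 <= w ->
  (forall n, s n <= s n.+1 <= s n + w / 2 ^+ n.+1) ->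
  exists p, forall n, s n <= p <= s n + w / 2 ^+ n.
Proof.
move=> w0 H.
have p2 n : 0 < (2 : R) ^+ n by rewrite exprn_gt0.
have E n : w / 2 ^+ n.+1 + w / 2 ^+ n.+1 = w / 2 ^+ n.
  rewrite exprS invfM; field; exact: lt0r_neq0.
have mono m k : s m <= s (m + k)%N.
  elim: k => [|k IH]; rewrite ?addn0 // addnS (le_trans IH) //.
  by case/andP: (H (m + k)%N).
have anti m k : s (m + k)%N + w / 2 ^+ (m + k) <= s m + w / 2 ^+ m.
  elim: k => [|k IH]; rewrite ?addn0 // addnS (le_trans _ IH) //.
  by case/andP: (H (m + k)%N) => _ h; rewrite -[in leRHS]E addrA lerD2r.
have ub n m : s m <= s n + w / 2 ^+ n.
  case: (leqP n m) => [/subnKC <-|/ltnW/subnKC <-].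
    by apply: (le_trans _ (anti n (m - n)%N)); rewrite lerDl divr_ge0 // ltW.
  by apply: le_trans (mono m (n - m)%N) _; rewrite lerDl divr_ge0 // ltW //.
have S : has_sup (range s).
  by split; [exists (s 0%N), 0%N|exists (s 0%N + w / 2 ^+ 0) => _ [m _ <-]; exact: ub].
exists (sup (range s)) => n; apply/andP; split.
  by apply: sup_upper_bound => //; exists n.
by apply: ge_sup; [case: S|move=> _ [m _ <-]; exact: ub].
Qed.

(** Bisection for a predicate on boxes: [P n x y] speaks of the box with lower left corner [(x, y)]
    and sides [w / 2 ^+ n] and [h / 2 ^+ n]. The successor is chosen as a total function, constant
    where [P] fails, and then iterated. *)
Lemma nested_boxes (w h a c : R) (P : nat -> R -> R -> Prop) :
  0 <= w -> 0 <= h -> P 0%N a c ->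
  (forall n x y, P n x y -> exists x' y',
     [/\ x <= x' <= x + w / 2 ^+ n.+1, y <= y' <= y + h / 2 ^+ n.+1
       & P n.+1 x' y']) ->
  exists p q, forall n, exists x y,
     [/\ P n x y, x <= p <= x + w / 2 ^+ n & y <= q <= y + h / 2 ^+ n].
Proof.
move=> w0 h0 P0 H.
have /choice[f Hf] : forall t : nat * (R * R), exists z : R * R,
    P t.1 t.2.1 t.2.2 ->
     [/\ t.2.1 <= z.1 <= t.2.1 + w / 2 ^+ t.1.+1,
         t.2.2 <= z.2 <= t.2.2 + h / 2 ^+ t.1.+1 & P t.1.+1 z.1 z.2].
  case=> n [x y]; have [/H[x' [y' K]]|K] := pselect (P n x y).
    by exists (x', y').
  by exists (x, y) => /K.
pose s := nat_rect (fun=> (R * R)%type) (a, c) (fun k r => f (k, r)).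
have Ps n : P n (s n).1 (s n).2.
  by elim: n => //= n IH; case: (Hf (n, s n) IH).
have Hs n := Hf (n, s n) (Ps n).
have [p Hp] : exists p, forall n, (s n).1 <= p <= (s n).1 + w / 2 ^+ n.
  by apply: (@nested_monotone w (fun n => (s n).1)) => // n; case: (Hs n).
have [q Hq] : exists p, forall n, (s n).2 <= p <= (s n).2 + h / 2 ^+ n.
  by apply: (@nested_monotone h (fun n => (s n).2)) => // n; case: (Hs n).
by exists p, q => n; exists (s n).1, (s n).2.
Qed.

Definition cts_rect G a b c d := forall x y, a <= x <= b -> c <= y <= d ->
  {for pt x y, continuous G}.

Lemma pt_sub x y x' y' : pt x y - pt x' y' = pt (x - x') (y - y') :> C.
Proof. by rewrite /pt !rcB mulrBr opprD addrACA. Qed.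

Lemma rn_pt_le x y : rn (pt x y : C) <= `|x| + `|y|.
Proof. by apply: le_trans (rnD _ _) _; rewrite rnM rn_ic mul1r !rn_rc. Qed.

Lemma continuous_pt1 y : continuous (fun x : R => pt x y).
Proof.
move=> x; rewrite /pt; apply: cvgD; last exact: cvg_cst.
exact: continuous_rc.
Qed.

Lemma continuous_pt2 x : continuous (fun y : R => pt x y).
Proof.
move=> y; rewrite /pt; apply: cvgD; first exact: cvg_cst.
by apply: cvgM; [exact: cvg_cst|exact: continuous_rc].
Qed.

Lemma cts_h G a b y :
  (forall x, a <= x <= b -> {for pt x y, continuous G}) ->
  cts_on a b (fun x => G (pt x y)).
Proof.
move=> H x xab; apply: (@continuous_comp _ _ _ (fun x : R => pt x y) G).
  exact: continuous_pt1.
exact: H.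
Qed.

Lemma cts_v G c d x :
  (forall y, c <= y <= d -> {for pt x y, continuous G}) ->
  cts_on c d (fun y => G (pt x y)).
Proof.
move=> H y ycd; apply: (@continuous_comp _ _ _ (fun y : R => pt x y) G).
  exact: continuous_pt2.
exact: H.
Qed.

Lemma rect_split_x G a m b c d : a <= m <= b -> c <= d ->
  cts_rect G a b c d ->
  rect G a b c d = rect G a m c d + rect G m b c d.
Proof.
move=> amb cd H; have /andP[am mb] := amb.
have cc : c <= c <= d by rewrite lexx.
have dd : c <= d <= d by rewrite cd lexx.
have Hc := cts_h (fun x h => H x c h cc).
have Hd := cts_h (fun x h => H x d h dd).
have am' : a <= a <= b by rewrite lexx (le_trans am).
have bm' : a <= b <= b by rewrite lexx (le_trans am).
have Ha := cts_v (fun y h => H a y am' h).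
have Hm := cts_v (fun y h => H m y amb h).
have Hb := cts_v (fun y h => H b y bm' h).
rewrite /rect (cint_cat amb (cts_onB Hc Hd)).
have -> : cint (fun y => G (pt b y) - G (pt a y)) c d =
  cint (fun y => G (pt m y) - G (pt a y)) c d +
  cint (fun y => G (pt b y) - G (pt m y)) c d.
  rewrite -(cintD (cts_onB Hm Ha) (cts_onB Hb Hm)).
  by apply: eq_cint => y _; ring.
by ring.
Qed.

Lemma rect_split_y G a b c m d : a <= b -> c <= m <= d ->
  cts_rect G a b c d ->
  rect G a b c d = rect G a b c m + rect G a b m d.
Proof.
move=> ab cmd H; have /andP[cm md] := cmd.
have aa : a <= a <= b by rewrite lexx.
have bb : a <= b <= b by rewrite ab lexx.
have cc : c <= c <= d by rewrite lexx (le_trans cm).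
have dd : c <= d <= d by rewrite lexx (le_trans cm).
have Hc := cts_h (fun x h => H x c h cc).
have Hd := cts_h (fun x h => H x d h dd).
have Hm := cts_h (fun x h => H x m h cmd).
have Ha := cts_v (fun y h => H a y aa h).
have Hb := cts_v (fun y h => H b y bb h).
rewrite /rect (cint_cat cmd (cts_onB Hb Ha)).
have -> : cint (fun x => G (pt x c) - G (pt x d)) a b =
  cint (fun x => G (pt x c) - G (pt x m)) a b +
  cint (fun x => G (pt x m) - G (pt x d)) a b.
  rewrite -(cintD (cts_onB Hc Hm) (cts_onB Hm Hd)).
  by apply: eq_cint => y _; ring.
by ring.
Qed.

Lemma rect_affine (k l : C) a b c d : a <= b -> c <= d ->
  rect (fun z => k + l * z) a b c d = 0.
Proof.
move=> ab cd; rewrite /rect.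
rewrite (@eq_cint _ _ _ _ (fun=> l * pt 0 (c - d))); last first.
  by move=> x _; rewrite -[0](subrr x) -pt_sub; ring.
rewrite [X in _ + _ * X](@eq_cint _ _ _ _ (fun=> l * pt (b - a) 0)); last first.
  by move=> y _; rewrite -[0](subrr y) -pt_sub; ring.
by rewrite !cint_cst // /pt rc0 !rcB; ring.
Qed.

Lemma rectB G H a b c d : a <= b -> c <= d -> cts_rect G a b c d ->
  cts_rect H a b c d ->
  rect (fun z => G z - H z) a b c d = rect G a b c d - rect H a b c d.
Proof.
move=> ab cd cG cH.
have aa : a <= a <= b by rewrite lexx.
have bb : a <= b <= b by rewrite ab lexx.
have cc : c <= c <= d by rewrite lexx.
have dd : c <= d <= d by rewrite cd lexx.
have Hc := cts_h (fun x h => cH x c h cc).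
have Hd := cts_h (fun x h => cH x d h dd).
have Ha := cts_v (fun y h => cH a y aa h).
have Hb := cts_v (fun y h => cH b y bb h).
have Gc := cts_h (fun x h => cG x c h cc).
have Gd := cts_h (fun x h => cG x d h dd).
have Ga := cts_v (fun y h => cG a y aa h).
have Gb := cts_v (fun y h => cG b y bb h).
rewrite /rect.
rewrite (@eq_cint _ _ _ _ (fun x => (G (pt x c) - G (pt x d)) - (H (pt x c) - H (pt x d))));
  last first.
  by move=> x _; ring.
rewrite (cintB (cts_onB Gc Gd) (cts_onB Hc Hd)).
rewrite [cint (fun y => _ - _ - (_ - _)) c d](@eq_cint _ _ _ _ (fun y => (G (pt b y) - G (pt a
  y)) - (H (pt b y) - H (pt a y)))); last first.
  by move=> x _; ring.
rewrite (cintB (cts_onB Gb Ga) (cts_onB Hb Ha)).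
by ring.
Qed.

Lemma rect_bound G a b c d M : a <= b -> c <= d -> cts_rect G a b c d ->
  (forall x y, a <= x <= b -> c <= y <= d -> rn (G (pt x y)) <= M) ->
  rn (rect G a b c d) <= 4 * M * ((b - a) + (d - c)).
Proof.
move=> ab cd cG B.
have aa : a <= a <= b by rewrite lexx.
have bb : a <= b <= b by rewrite ab lexx.
have cc : c <= c <= d by rewrite lexx.
have dd : c <= d <= d by rewrite cd lexx.
have Gc := cts_h (fun x h => cG x c h cc).
have Gd := cts_h (fun x h => cG x d h dd).
have Ga := cts_v (fun y h => cG a y aa h).
have Gb := cts_v (fun y h => cG b y bb h).
apply: le_trans (rnD _ _) _; rewrite rnM rn_ic mul1r mulrDr.
have -> : 4 * M = 2 * (M + M) by ring.
apply: lerD.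
- apply: (cint_bound ab (cts_onB Gc Gd)) => x xab.
  by apply: le_trans (rnB _ _) _; apply: lerD; exact: B.
- apply: (cint_bound cd (cts_onB Gb Ga)) => y ycd.
  by apply: le_trans (rnB _ _) _; apply: lerD; exact: B.
Qed.

End Goursat.

Section Goursat2.
Variable R : realType.
Local Notation C := (CC R).
Implicit Types G : C -> C.

Lemma le0_eps (x K : R) : (forall e, 0 < e -> x <= K * e) -> x <= 0.
Proof.
move=> H; rewrite leNgt; apply/negP => x0.
have K0 : 0 < `|K| + 1 by rewrite ltr_wpDl.
have e0 : 0 < x / (`|K| + 1) / 2 by rewrite !divr_gt0.
have := H _ e0; apply/negP; rewrite -ltNge.
apply: le_lt_trans (_ : (`|K| + 1) * (x / (`|K| + 1) / 2) < x).
  by rewrite ler_wpM2r ?(ltW e0) // (le_trans (ler_norm K)) // lerDl.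
have -> : (`|K| + 1) * (x / (`|K| + 1) / 2) = x / 2 by field; rewrite gt_eqF.
by lra.
Qed.

Lemma pow2_small (K d : R) : 0 < d -> exists n, K / 2 ^+ n < d.
Proof.
move=> d0; exists (Num.bound (`|K| / d)).
rewrite ltr_pdivrMr ?exprn_gt0 //.
have := archi_boundP (divr_ge0 (normr_ge0 K) (ltW d0)).
rewrite ltr_pdivrMr // => H; apply: le_lt_trans (ler_norm K) _.
apply: lt_le_trans H _; rewrite mulrC ler_wpM2l ?(ltW d0) //.
by rewrite -natrX ler_nat ltnW // ltn_expl.
Qed.

(** Pigeonhole for the four quarters of a rectangle in [goursat]. *)
Lemma four_lt (J p q r s : R) : p < J -> q < J -> r < J -> s < J ->
  4 * J <= p + q + (r + s) -> False.
Proof. by lra. Qed.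

Lemma dist_le_itv (x w s t : R) : x <= s -> s <= x + w -> x <= t -> t <= x + w ->
  `|s - t| <= w.
Proof. by move=> *; rewrite ler_norml; apply/andP; split; lra. Qed.

(** Each bisection keeps a quarter that carries at least a fourth of the integral. Near the limit
    point [G] is affine up to [e] times the distance, and the affine part integrates to 0. Diameter
    and perimeter both scale like [1 / 2 ^+ n], which exactly compensates the factor [4 ^+ n]. *)
Lemma goursat G a b c d : a <= b -> c <= d ->
  (forall x y, a <= x <= b -> c <= y <= d -> differentiable G (pt x y)) ->
  rect G a b c d = 0.
Proof.
move=> ab cd dG.
have cG a' b' c' d' : a <= a' -> b' <= b -> c <= c' -> d' <= d ->
    cts_rect G a' b' c' d'.
  move=> ha hb hc hd x y /andP[ax xb] /andP[cy yd].
  apply: differentiable_continuous; apply: dG.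
    by rewrite (le_trans ha) // (le_trans xb).
  by rewrite (le_trans hc) // (le_trans yd).
apply/eqP; rewrite -rn_eq0 eq_le rn_ge0 andbT.
set I0 := rn _; set w := b - a; set h := d - c.
have w0 : 0 <= w by rewrite subr_ge0.
have h0 : 0 <= h by rewrite subr_ge0.
have p2 n : 0 < (2 : R) ^+ n by rewrite exprn_gt0.
pose P n x y := [/\ a <= x, x + w / 2 ^+ n <= b, c <= y, y + h / 2 ^+ n <= d
  & I0 / 4 ^+ n <= rn (rect G x (x + w / 2 ^+ n) y (y + h / 2 ^+ n))].
have P0 : P 0%N a c.
  by rewrite /P !expr0 !divr1 /w /h !(addrC a) !(addrC c) !subrK; split.
have [|p [q Hpq]] := nested_boxes w0 h0 P0.
  move=> n x y [ax xb cy yd HI].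
  have E (t : R) : t / 2 ^+ n = t / 2 ^+ n.+1 + t / 2 ^+ n.+1.
    by rewrite [2 ^+ n.+1]exprS; field; exact: lt0r_neq0.
  have E4 : I0 / 4 ^+ n = 4 * (I0 / 4 ^+ n.+1).
    by rewrite [4 ^+ n.+1]exprS; field; rewrite expf_neq0.
  move: HI xb yd; rewrite E4 (E w) (E h) !addrA.
  have wn0 : 0 <= w / 2 ^+ n.+1 by rewrite divr_ge0 // ltW.
  have hn0 : 0 <= h / 2 ^+ n.+1 by rewrite divr_ge0 // ltW.
  move: wn0 hn0; rewrite /P.
  set w' := w / 2 ^+ n.+1; set h' := h / 2 ^+ n.+1; set J := I0 / _.
  move=> wn0 hn0 HI xb yd.
  have X1 : x <= x + w' by rewrite lerDl.
  have X2 : x + w' <= x + w' + w' by rewrite lerDl.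
  have Y1 : y <= y + h' by rewrite lerDl.
  have Y2 : y + h' <= y + h' + h' by rewrite lerDl.
  have X3 := le_trans X1 X2. have Y3 := le_trans Y1 Y2.
  have xb' := le_trans X2 xb; have yd' := le_trans Y2 yd.
  have ax' := le_trans ax X1; have cy' := le_trans cy Y1.
  rewrite (@rect_split_x _ _ _ (x + w')) ?X1 ?X2 // in HI; last exact: cG.
  rewrite (@rect_split_y _ _ x (x + w') _ (y + h')) ?Y1 ?Y2 // in HI; last exact: cG.
  rewrite (@rect_split_y _ _ (x + w') _ _ (y + h')) ?Y1 ?Y2 // in HI; last exact: cG.
  have [A|A] := lerP J (rn (rect G x (x + w') y (y + h'))).
    exists x, y; split; [by rewrite lexx|by rewrite lexx|exact: And5 ax xb' cy yd' A].
  have [B|B] := lerP J (rn (rect G x (x + w') (y + h') (y + h' + h'))).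
    exists x, (y + h'); split; [by rewrite lexx|by rewrite Y1 lexx|exact: And5 ax xb' cy' yd B].
  have [D|D] := lerP J (rn (rect G (x + w') (x + w' + w') y (y + h'))).
    exists (x + w'), y; split; [by rewrite X1 lexx|by rewrite lexx|exact: And5 ax' xb cy yd' D].
  have [F|F] := lerP J (rn (rect G (x + w') (x + w' + w') (y + h') (y + h' + h'))).
    exists (x + w'), (y + h'); split;
      [by rewrite X1 lexx|by rewrite Y1 lexx|exact: And5 ax' xb cy' yd F].
  have := le_trans HI (le_trans (rnD _ _) (lerD (rnD _ _) (rnD _ _))).
  by case/(four_lt A B D F).
(* The constant is that of [rect_bound] for a deviation [e * (w' + h')] on a rectangle with sides
   [w'] and [h'], multiplied by [4 ^+ n]. *)
apply: (@le0_eps _ (4 * (w + h) ^+ 2)) => e e0.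
have Dpq : differentiable G (pt p q).
  have [x [y [[ax xb cy yd _] /andP[xp px] /andP[yq qy]]]] := Hpq 0%N.
  apply: dG; apply/andP; split.
  - exact: le_trans ax xp.
  - exact: le_trans px xb.
  - exact: le_trans cy yq.
  - exact: le_trans qy yd.
have [dl d0 Hd] := diff_rnP Dpq e0.
have [n Hn] := pow2_small (w + h) d0.
have [x [y [[ax xb cy yd HI] /andP[xp px] /andP[yq qy]]]] := Hpq n.
have wn0 : 0 <= w / 2 ^+ n by rewrite divr_ge0 // ltW.
have hn0 : 0 <= h / 2 ^+ n by rewrite divr_ge0 // ltW.
move: Hn HI xb yd px qy; rewrite mulrDl; set w' := w / _; set h' := h / _.
move=> Hn HI xb yd px qy.
have X1 : x <= x + w' by rewrite lerDl.
have Y1 : y <= y + h' by rewrite lerDl.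
set l : C := 'd G (pt p q) (1 : C).
pose A (z : C) := (G (pt p q) - l * pt p q) + l * z.
have cA u1 u2 u3 u4 : cts_rect A u1 u2 u3 u4.
  move=> s t _ _; apply: (@continuousD _ _ _ (fun=> _) (fun z => l * z)).
    exact: cst_continuous.
  apply: (@continuousM _ _ (fun=> l) id); first exact: cst_continuous.
  exact: cvg_id.
have cGr := cG _ _ _ _ ax xb cy yd.
have : rn (rect (fun z => G z - A z) x (x + w') y (y + h')) <=
    4 * (e * (w' + h')) * ((x + w' - x) + (y + h' - y)).
  apply: (rect_bound X1 Y1).
    by move=> s t hs ht; apply: (@continuousB _ _ _ G A);
      [exact: (cGr s t hs ht)|exact: (cA _ _ _ _ s t hs ht)].
  move=> s t /andP[hs1 hs2] /andP[ht1 ht2].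
  have K : rn (pt s t - pt p q : C) <= w' + h'.
    rewrite pt_sub; apply: le_trans (rn_pt_le _ _) _; apply: lerD.
      exact: dist_le_itv hs1 hs2 xp px.
    exact: dist_le_itv ht1 ht2 yq qy.
  have := Hd (pt s t - pt p q) (le_lt_trans K Hn).
  rewrite subrK => Q; apply: (@le_trans _ _ (e * rn (pt s t - pt p q : C))); last first.
    by rewrite ler_wpM2l // ltW.
  apply: le_trans Q; rewrite le_eqVlt; apply/orP; left; apply/eqP; congr rn.
  rewrite -[in RHS](mulr1 (pt s t - pt p q)) -[in RHS]/((pt s t - pt p q) *: (1 : C)).
  by rewrite linearZ /= -/l /A /GRing.scale /=; ring.
rewrite (rectB X1 Y1 cGr (cA _ _ _ _)) (rect_affine _ _ X1 Y1) subr0.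
have -> : 4 * (e * (w' + h')) * (x + w' - x + (y + h' - y)) =
    (4 * (w + h) ^+ 2 * e) / 4 ^+ n.
  have -> : (4 : R) ^+ n = 2 ^+ n * 2 ^+ n by rewrite -exprMn -natrM.
  by rewrite /w' /h'; field; exact: lt0r_neq0.
move/(le_trans HI); rewrite ler_pM2r // invr_gt0 exprn_gt0 //.
Qed.
End Goursat2.

(** * Means over circles *)

Definition cis (R : realType) (t : R) : CC R := pt (cos t) (sin t).
Definition cexp (R : realType) (w : CC R) : CC R := rc (expR (cRe w)) * cis (cIm w).
Definition avg (R : realType) (g : R -> CC R) : CC R :=
  (rc (2 * pi))^-1 * cint g 0 (2 * pi).
Definition mean (R : realType) (r : R) (h : CC R -> CC R) : CC R :=
  avg (fun t => h (rc r * cis t)).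

(** * The complex exponential *)

Section Cexp.
Variable R : realType.
Local Notation C := (CC R).

Lemma cRe_pt (s t : R) : cRe (pt s t) = s.
Proof. by rewrite /pt cReD cReM /= mul0r mulr0 subrr addr0. Qed.
Lemma cIm_pt (s t : R) : cIm (pt s t) = t.
Proof. by rewrite /pt cImD cImM /= mul0r mul1r !add0r. Qed.
Lemma ptE (z : C) : z = pt (cRe z) (cIm z).
Proof. exact: CCE. Qed.

Lemma ic2 : ic R * ic R = -1.
Proof. by apply: Cext;
  rewrite /ic /cRe /cIm /= ?mulr0 ?mul0r ?mul1r ?oppr0 ?addr0 ?sub0r ?oppr0. Qed.

Lemma ptM (a b c d : R) : pt a b * pt c d = pt (a * c - b * d) (a * d + b * c).
Proof.
rewrite /pt !(rcB, rcD, rcM); transitivity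
 (rc a * rc c + (ic R * ic R) * (rc b * rc d) + ic R * (rc a * rc d + rc b * rc c)).
  by ring.
by rewrite ic2; ring.
Qed.

Lemma cexpD (z w : C) : cexp (z + w) = cexp z * cexp w.
Proof.
rewrite /cexp cReD cImD expRD rcM /cis cosD sinD.
rewrite mulrACA ptM; congr (_ * pt _ _).
by rewrite addrC [sin _ * cos _]mulrC.
Qed.

Lemma rn_cis t : rn (cis t : C) = 1.
Proof. by rewrite rnE /cis cRe_pt cIm_pt cos2Dsin2 sqrtr1. Qed.

Lemma cexp_pt (s t : R) : cexp (pt s t) = rc (expR s) * cis t.
Proof. by rewrite /cexp cRe_pt cIm_pt. Qed.

Lemma real_deriv (u : R -> R) (x l : R) : is_derive x 1 u l ->
  forall e, 0 < e -> exists2 d, 0 < d &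
  forall k, `|k| < d -> `|u (k + x) - u x - l * k| <= e * `|k|.
Proof.
move=> [du <-] e e0; have Du : differentiable u x by apply/derivable1_diffP.
have /diff_locallyP [_ /eqaddoP H] := Du.
have /nbhs_ballP[d /= d0 K] := H e e0.
exists d => // k kd; have /= := K k; rewrite -ball_normE /= sub0r normrN => /(_ kd).
rewrite !fctE /= opprD addrA => Q; apply: le_trans Q.
suff -> : 'D_1 u x * k = 'd u x k by [].
rewrite deriveE // mulrC -[LHS]/(k *: 'd u x 1) -linearZ /=.
by congr ('d u x _); exact: mulr1.
Qed.

Lemma cexp0_diff (e : R) : 0 < e -> exists2 d, 0 < d &
  forall k : C, rn k < d -> rn (cexp k - 1 - k) <= e * rn k.
Proof.
(* The error splits below into six terms of size [e' * rn k], whence [e / 6]; the cap [1 / 2] keeps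
   [expR s <= 2]. *)
move=> e0; pose e' := Num.min (e / 6) (1 / 2).
have e'0 : 0 < e' by rewrite lt_min; apply/andP; split; lra.
have e'1 : e' <= e / 6 by rewrite ge_min lexx.
have e'2 : e' <= 1 / 2 by rewrite ge_min lexx orbT.
have [d1 d10 H1] := real_deriv (is_derive_expR 0) e'0.
have [d2 d20 H2] := real_deriv (is_derive_cos 0) e'0.
have [d3 d30 H3] := real_deriv (is_derive_sin 0) e'0.
exists (Num.min (Num.min d1 d2) (Num.min d3 (e' / 2))).
  by rewrite !lt_min d10 d20 d30 /=; lra.
move=> k; rewrite !lt_min => /andP[/andP[k1 k2] /andP[k3 k4]].
have Rk := Re_le_rn k; have Ik := Im_le_rn k.
set s := cRe k in Rk *; set t := cIm k in Ik *.
have := H1 s (le_lt_trans Rk k1); rewrite addr0 expR0 mul1r.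
have := H2 t (le_lt_trans Ik k2); rewrite addr0 cos0 sin0 oppr0 mul0r subr0.
have := H3 t (le_lt_trans Ik k3); rewrite addr0 cos0 sin0 subr0 mul1r.
move=> h3 h2 h1.
have hs : `|expR s - 1| <= 2 * `|s|.
  rewrite -(subrK s (expR s - 1)); apply: le_trans (ler_normD _ _) _.
  apply: le_trans (lerD h1 (lexx _)) _; have := normr_ge0 s; nra.
have hE : expR s <= 2.
  have := ler_norm (expR s - 1); lra.
apply: le_trans (rn_le_ReIm _) _.
rewrite /cexp cReD cImD !cReD !cImD !cReN !cImN cReM cImM /cis cRe_pt cIm_pt -/s -/t.
have -> : cRe (rc (expR s) : C) = expR s by [].
have -> : cIm (rc (expR s) : C) = 0 by [].
have -> : cRe (1 : C) = 1 by []. have -> : cIm (1 : C) = 0 by [].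
rewrite !mul0r subr0 addr0 oppr0 addr0.
have A1 : `|expR s * cos t - 1 - s| <= 2 * (e' * `|t|) + e' * `|s|.
  have -> : expR s * cos t - 1 - s = expR s * (cos t - 1) + (expR s - 1 - s) by ring.
  apply: le_trans (ler_normD _ _) _; rewrite lerD // normrM.
  by rewrite ler_pM // ger0_norm // expR_ge0.
have A2 : `|expR s * sin t - t| <= 2 * (e' * `|t|) + 2 * `|s| * `|t|.
  have -> : expR s * sin t - t = expR s * (sin t - t) + (expR s - 1) * t by ring.
  apply: le_trans (ler_normD _ _) _; rewrite lerD // normrM.
    by rewrite ler_pM // ger0_norm // expR_ge0.
  by rewrite ler_wpM2r.
have n1 := normr_ge0 s; have n2 := normr_ge0 t.
apply: le_trans (lerD A1 A2) _.
have := rn_ge0 k; nra.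
Qed.

Lemma linear_rnP_diff (V W : normedModType C) (f : V -> W) v (L : V -> W) (M : R) :
  linear L -> (forall k, rn (L k) <= M * rn k) ->
  (forall e : R, 0 < e -> exists2 d : R, 0 < d & forall k, rn k < d ->
    rn (f (k + v) - f v - L k) <= e * rn k) -> differentiable f v.
Proof.
move=> Llin LM H.
pose L' : {linear V -> W} := HB.pack L (GRing.isLinear.Build _ _ _ _ L Llin).
exact: (@rnP_diff R V W f v L' M).
Qed.

(** Differentiability depends on the germ only. This serves where a formula holds just locally: for
    [slope] away from [y], and for [ext] with its radius frozen. *)
Lemma near_eq_diff (V W : normedModType C) (g h : V -> W) z :
  (\forall w \near z, g w = h w) -> differentiable g z -> differentiable h z.
Proof.
move=> /nbhs_rnP[d1 d10 E] G.
have [r r0 L] : exists2 r : R, 0 < r & forall k, rn ('d g z k) <= r * rn k.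
  have /linear_boundedP : bounded_near ('d g z) (nbhs (0 : V)).
    by apply: continuous_linear_bounded; exact: diff_continuous.
  move=> /pinfty_ex_gt0[_ /gt0_rc[r r0 ->] H]; exists r => // k.
  by have := H k; rewrite !normE -rcM rc_le.
apply: (@rnP_diff _ _ _ h z ('d g z) r L) => e e0.
have [d d0 K] := diff_rnP G e0.
exists (Num.min d d1) => [|k]; rewrite lt_min ?d0 // => /andP[kd kd1].
rewrite -!E ?subrr ?rn0 ?addrK //; exact: K.
Qed.

Lemma cdiffP (h : C -> C) (z l : C) :
  (forall e : R, 0 < e -> exists2 d : R, 0 < d & forall k, rn k < d ->
    rn (h (k + z) - h z - l * k) <= e * rn k) -> differentiable h z.
Proof.
move=> H; apply: (@linear_rnP_diff _ _ h z (fun k => l * k) (rn l)) => //.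
- by move=> a x y; rewrite /GRing.scale /=; ring.
- by move=> k; rewrite rnM.
Qed.

Lemma differentiable_cexp (w : C) : differentiable (@cexp R) w.
Proof.
apply: (@cdiffP _ _ (cexp w)) => e e0.
have e'0 : 0 < e / (rn (cexp w) + 1) by rewrite divr_gt0 // ltr_wpDl // rn_ge0.
have [d d0 H] := cexp0_diff e'0; exists d => // k /H K.
have -> : cexp (k + w) - cexp w - cexp w * k = cexp w * (cexp k - 1 - k).
  by rewrite cexpD; ring.
rewrite rnM; have n0 := rn_ge0 (cexp w).
apply: le_trans (ler_wpM2l n0 K) _.
rewrite mulrA ler_wpM2r ?rn_ge0 // mulrCA ler_piMr ?(ltW e0) //.
by rewrite ler_pdivrMr ?mul1r ?lerDl // ltr_wpDl.
Qed.
End Cexp.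

Section Avg.
Variable R : realType.
Local Notation C := (CC R).
Implicit Types g : R -> C.
Local Notation cts := (cts_on 0 (2 * (pi : R))).

Lemma pi2_gt0 : 0 < 2 * (pi : R).
Proof. by rewrite mulr_gt0 // pi_gt0. Qed.
Let pi2_ge0 : 0 <= 2 * (pi : R) := ltW pi2_gt0.

Lemma eq_avg g1 g2 : g1 =1 g2 -> avg g1 = avg g2.
Proof. by move=> E; congr (_ * _); apply: eq_cint. Qed.
Lemma avgD g1 g2 : cts g1 -> cts g2 ->
  avg (fun t => g1 t + g2 t) = avg g1 + avg g2.
Proof. by move=> G H; rewrite /avg (cintD G H) mulrDr. Qed.
Lemma avgB g1 g2 : cts g1 -> cts g2 ->
  avg (fun t => g1 t - g2 t) = avg g1 - avg g2.
Proof. by move=> G H; rewrite /avg (cintB G H) mulrBr. Qed.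
Lemma avgZ (k : C) g : cts g -> avg (fun t => k * g t) = k * avg g.
Proof. by move=> G; rewrite /avg (cintZ k G) mulrCA. Qed.
Lemma avg_cst (k : C) : avg (fun=> k) = k.
Proof.
rewrite /avg (cint_cst _ pi2_ge0) subr0 mulKf // rc_eq0 gt_eqF //.
exact: pi2_gt0.
Qed.
Lemma avg_bound g M : cts g -> (forall t, 0 <= t <= 2 * pi -> rn (g t) <= M) ->
  rn (avg g) <= 2 * M.
Proof.
move=> G H; rewrite /avg rnM rnV rn_rc ger0_norm //.
rewrite mulrC ler_pdivrMr ?pi2_gt0 //.
by have := cint_bound pi2_ge0 G H; rewrite subr0.
Qed.

(** The tube argument: the interval is compact, so joint continuity along it yields one
    neighbourhood of [x0] that works for all [t]. *)
Lemma unif_near (X : topologicalType) (x0 : X) (f : X -> R -> C) (a b : R) :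
  (forall t, a <= t <= b ->
    {for (x0, t), continuous (fun z : X * R => f z.1 z.2)}) ->
  forall e, 0 < e -> \forall x \near x0, forall t, a <= t <= b ->
    rn (f x t - f x0 t) < e.
Proof.
move=> H e e0.
have /compact_near_coveringP K : compact `[a, b]%classic by exact: segment_compact.
have := K X (nbhs x0) (fun x t => rn (f x t - f x0 t) < e) (nbhs_filter x0).
move=> {}K; apply: filterS (K _) => [x Hx t ht|t ht].
  by apply: Hx; rewrite /= in_itv.
have ht' : a <= t <= b by move: ht; rewrite /= in_itv.
have /cvg_rnP/(_ (e / 2)) := H t ht'.
rewrite divr_gt0 // => /(_ isT) [[A B] /= [Ax Bt] AB].
exists (B, A) => //= -[t' x'] [/= Bt' Ax'].
have h1 := AB (x', t') (conj Ax' Bt').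
have h2 := AB (x0, t') (conj (nbhs_singleton Ax) Bt').
rewrite /= in h1 h2.
change (rn (f x' t' - f x0 t') < e); have D := rn_distD (f x0 t) (f x' t') (f x0 t');
  apply: (le_lt_trans D).
rewrite (rn_distC (f x0 t)); lra.
Qed.
End Avg.

Section Mean.
Variable R : realType.
Local Notation C := (CC R).
Implicit Types h g : C -> C.
Local Notation cts := (cts_on 0 (2 * (pi : R))).

Lemma rn_circle (r t : R) : 0 <= r -> rn (rc r * cis t : C) = r.
Proof. by move=> r0; rewrite rnM rn_cis mulr1 rn_rc ger0_norm. Qed.

Lemma continuous_cis : continuous (@cis R).
Proof.
move=> t; rewrite /cis /pt; apply: cvgD.
  exact: (cvg_comp _ _ (@continuous_cos R t) (@continuous_rc R (cos t))).
apply: cvgM; first exact: cvg_cst.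
exact: (cvg_comp _ _ (@continuous_sin R t) (@continuous_rc R (sin t))).
Qed.

Lemma cts_circle r h : 0 <= r ->
  (forall z : C, rn z = r -> {for z, continuous h}) ->
  cts (fun t => h (rc r * cis t)).
Proof.
move=> r0 H t _; apply: (@continuous_comp _ _ _ (fun t : R => rc r * cis t) h).
  by apply: cvgM; [exact: cvg_cst|exact: continuous_cis].
by apply: H; rewrite rn_circle.
Qed.

(* Goursat for [h \o cexp] on [[ln r1, ln r2] x [0, 2 pi]]: the horizontal sides
   cancel by periodicity. *)
Lemma mean_annulus r1 r2 h : 0 < r1 -> r1 <= r2 ->
  (forall z, r1 <= rn z <= r2 -> differentiable h z) ->
  mean r1 h = mean r2 h.
Proof.
move=> r10 r12 H.
have r20 : 0 < r2 by apply: lt_le_trans r12.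
have ln12 : ln r1 <= ln r2 by rewrite ler_ln ?posrE.
have p0 : 0 <= 2 * (pi : R) := ltW (pi2_gt0 R).
have rE (r t : R) : 0 < r -> cexp (pt (ln r) t) = rc r * cis t :> C.
  by move=> r0; rewrite cexp_pt lnK // posrE.
have D x y : ln r1 <= x <= ln r2 -> 0 <= y <= 2 * pi ->
    differentiable (h \o @cexp R) (pt x y).
  move=> /andP[x1 x2] _; apply: differentiable_comp.
    exact: differentiable_cexp.
  apply: H; rewrite cexp_pt rn_circle ?expR_ge0 //.
  by rewrite -{1}(lnK r10) -{1}(lnK r20) !ler_expR x1.
have := goursat ln12 p0 D; rewrite /rect.
rewrite (@eq_cint _ _ _ _ (fun=> 0)); last first.
  by move=> x _ /=; rewrite !cexp_pt /cis mulr_natl cos2pi sin2pi cos0 sin0 subrr.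
rewrite cint_cst // mulr0 add0r => /eqP; rewrite mulf_eq0.
have -> : (ic R == 0) = false by rewrite -rn_eq0 rn_ic oner_eq0.
rewrite /= (@eq_cint _ _ _ _ (fun y => h (rc r2 * cis y) - h (rc r1 * cis y))); last first.
  by move=> y _ /=; rewrite !rE.
rewrite cintB ?subr_eq0; first by move=> /eqP E; rewrite /mean /avg E.
- apply: cts_circle; first exact: ltW.
  by move=> z E; apply/differentiable_continuous/H; rewrite E lexx r12.
- apply: cts_circle; first exact: ltW.
  by move=> z E; apply/differentiable_continuous/H; rewrite E lexx r12.
Qed.

(** Continuity of the mean in the radius, relative to [[r1, r2]], so that it also applies at the end
    points and in particular at radius 0. *)
Lemma mean_continuous h s r1 r2 : 0 <= r1 -> r1 <= s <= r2 ->
  (forall z, r1 <= rn z <= r2 -> {for z, continuous h}) ->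
  forall e : R, 0 < e -> exists2 d, 0 < d & forall r, r1 <= r <= r2 -> `|r - s| < d ->
    rn (mean r h - mean s h) <= e.
Proof.
move=> r10 /andP[r1s sr2] H e e0.
have s0 : 0 <= s by apply: le_trans r1s.
have : \forall r \near s, forall t, 0 <= t <= 2 * pi ->
    rn (h (rc r * cis t) - h (rc s * cis t)) < e / 2.
  apply: (@unif_near R R s (fun r t => h (rc r * cis t))); last by rewrite divr_gt0.
  move=> t _.
  apply: (@continuous_comp _ _ _ (fun z : R * R => rc z.1 * cis z.2) h).
    apply: cvgM.
      by apply: (@continuous_comp _ _ _ fst (@rc R)); [exact: cvg_fst|exact: continuous_rc].
    by apply: (@continuous_comp _ _ _ snd (@cis R)); [exact: cvg_snd|exact: continuous_cis].
  by apply: H; rewrite rn_circle // r1s.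
move=> /nbhs_ballP[d /= d0 K]; exists d => // r /andP[rr1 rr2] rd.
have r0 : 0 <= r by apply: le_trans rr1.
have cr : cts (fun t => h (rc r * cis t)).
  by apply: cts_circle => // z E; apply: H; rewrite E rr1.
have cs : cts (fun t => h (rc s * cis t)).
  by apply: cts_circle => // z E; apply: H; rewrite E r1s.
rewrite /mean -(avgB cr cs).
have -> : e = 2 * (e / 2) by field.
apply: avg_bound; first exact: cts_onB.
move=> t ht; apply/ltW/K => //; by rewrite -ball_normE /= distrC.
Qed.

Lemma eq_eps (z : C) : (forall e : R, 0 < e -> rn z <= e) -> z = 0.
Proof.
move=> H; apply/eqP; rewrite -rn_eq0 eq_le rn_ge0 andbT.
by apply: (@le0_eps _ _ 1) => e e0; rewrite mul1r; exact: H.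
Qed.

(* The circle [rn z = s0] is crossed by continuity of [r |-> mean r h]; this replaces
   the removability of the singularity of a difference quotient. *)
Lemma mean_annulus_except r1 r2 s0 h : 0 < r1 -> r1 <= r2 ->
  (forall z, r1 <= rn z <= r2 -> {for z, continuous h}) ->
  (forall z, r1 <= rn z <= r2 -> rn z != s0 -> differentiable h z) ->
  mean r1 h = mean r2 h.
Proof.
move=> r10 r12 Hc Hd.
have piece a b : r1 <= a -> a <= b -> b <= r2 -> (b < s0) || (s0 < a) ->
    mean a h = mean b h.
  move=> ra ab br sab; apply: mean_annulus => //; first exact: lt_le_trans ra.
  move=> z /andP[az zb]; apply: Hd; first by rewrite (le_trans ra) // (le_trans zb).
  apply/eqP => zs; move: sab; rewrite -zs.
  by rewrite !ltNge zb az.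
have [H|H] := boolP ((r2 < s0) || (s0 < r1)); first exact: piece.
move: H; rewrite negb_or -!leNgt => /andP[s0r2 r1s0].
have near_s0 r : r1 <= r <= r2 -> mean r h = mean s0 h.
  move=> /andP[ra rb]; apply/eqP; rewrite -subr_eq0; apply/eqP/eq_eps => e e0.
  have r1s02 : r1 <= s0 <= r2 by rewrite r1s0.
  have [d d0 K] := mean_continuous (ltW r10) r1s02 Hc e0.
  case: (ltgtP r s0) => rs; last by rewrite rs subrr rn0 ltW.
  (* [r'] lies on the same side of [s0] as [r] and within [d] of [s0]: the annulus between [r] and
     [r'] avoids the exceptional circle, and continuity covers the rest. *)
  - pose r' := Num.max r (s0 - d / 2).
    have rr' : r <= r' by rewrite le_max lexx.
    have r's : r' < s0 by rewrite gt_max rs /=; lra.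
    have r'd : s0 - d / 2 <= r' by rewrite le_max lexx orbT.
    have r'2 : r' <= r2 := le_trans (ltW r's) s0r2.
    rewrite (piece r r') ?r's //; apply: K.
      by rewrite (le_trans ra rr').
    by rewrite ltr_norml; apply/andP; split; lra.
  - pose r' := Num.min r (s0 + d / 2).
    have rr' : r' <= r by rewrite ge_min lexx.
    have r's : s0 < r' by rewrite lt_min rs /=; lra.
    have r'd : r' <= s0 + d / 2 by rewrite ge_min lexx orbT.
    have r'1 : r1 <= r' := le_trans r1s0 (ltW r's).
    rewrite -(piece r' r) ?r's ?orbT //; apply: K.
      by rewrite r'1 (le_trans rr').
    by rewrite ltr_norml; apply/andP; split; lra.
by rewrite !near_s0 ?lexx ?r12.
Qed.

Lemma mean0 h : mean 0 h = h 0.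
Proof. by rewrite /mean -[RHS]avg_cst; apply: eq_avg => t; rewrite rc0 mul0r. Qed.

(** The mean does not depend on the radius and tends to the value at the centre as the radius
    shrinks. A negative [s0] makes the exceptional circle empty. *)
Lemma mean_disc r s0 h : 0 < r ->
  (forall z, rn z <= r -> {for z, continuous h}) ->
  (forall z, rn z <= r -> rn z != s0 -> differentiable h z) ->
  mean r h = h 0.
Proof.
move=> r0 Hc Hd; rewrite -mean0.
apply/eqP; rewrite -subr_eq0; apply/eqP/eq_eps => e e0.
have Hc' z : 0 <= rn z <= r -> {for z, continuous h} by move=> /andP[_]; exact: Hc.
have r00 : (0 : R) <= 0 <= r by rewrite lexx ltW.
have [d d0 K] := mean_continuous (lexx 0) r00 Hc' e0.
pose r' := Num.min r (d / 2).
have r'0 : 0 < r' by rewrite lt_min r0 divr_gt0.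
have r'r : r' <= r by rewrite ge_min lexx.
have r'd : r' <= d / 2 by rewrite ge_min lexx orbT.
rewrite -(@mean_annulus_except r' r s0) //.
- apply: K; first by rewrite ltW.
  by rewrite subr0 gtr0_norm //; lra.
- by move=> z /andP[_]; exact: Hc.
- by move=> z /andP[_]; exact: Hd.
Qed.

End Mean.

(** * Cauchy's formula, Laurent splitting and a second-order estimate *)

(** The Cauchy kernel [1 / (z - y)] times [z], because [dz / (2 pi i)] on a circle around 0 is [z]
    times the normalized angle measure. *)
Definition ckernel (R : realType) (y z : CC R) : CC R := z / (z - y).
Definition cauchy_mean (R : realType) (r : R) (g : CC R -> CC R) (y : CC R) : CC R :=
  mean r (fun z => g z * ckernel y z).
(** Filled in at [y] so as to be continuous there. Its differentiability at [y] is never claimed: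
    the circle through [y] is the exceptional one in [mean_annulus_except]. *)
Definition slope (R : realType) (g : CC R -> CC R) (y z : CC R) : CC R :=
  if z == y then 'd g y (1 : CC R) else (g z - g y) / (z - y).

Section Cauchy.
Variable R : realType.
Local Notation C := (CC R).
Implicit Types g h : C -> C.

Lemma diff1_mul g z k : 'd g z (k : C) = 'd g z (1 : C) * k.
Proof.
rewrite -[in LHS](mulr1 k) -[k * 1]/(k *: (1 : C)) linearZ /=.
by rewrite mulrC.
Qed.

Lemma differentiable_idC (z : C) : differentiable (id : C -> C) z.
Proof. by []. Qed.

Lemma differentiable_subC (y z : C) : differentiable (fun z : C => z - y) z.
Proof.
by apply: (@differentiableB _ _ _ id (fun=> y)) => //; exact: differentiable_cst.
Qed.

Lemma differentiable_inv_sub (y z : C) : z != y ->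
  differentiable (fun z : C => (z - y)^-1) z.
Proof.
move=> zy; apply: (@differentiableV _ _ (fun z : C => z - y)).
  exact: differentiable_subC.
by rewrite subr_eq0.
Qed.

Lemma differentiable_ckernel (y z : C) : z != y -> differentiable (ckernel y) z.
Proof.
move=> zy; apply: (@differentiableM _ _ id (fun z : C => (z - y)^-1)).
  exact: differentiable_idC.
exact: differentiable_inv_sub.
Qed.

Lemma slope_diff g y z : z != y -> differentiable g z ->
  differentiable (slope g y) z.
Proof.
move=> zy G.
apply: (@near_eq_diff _ C C (fun z => (g z - g y) * (z - y)^-1)).
  apply/nbhs_rnP; exists (rn (z - y)); first by rewrite rn_gt0 subr_eq0.
  move=> w wz; rewrite /slope; case: eqVneq wz => // ->.
  by rewrite rn_distC ltxx.
apply: (@differentiableM _ _ (fun z => g z - g y) (fun z : C => (z - y)^-1)).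
  by apply: (@differentiableB _ _ _ g (fun=> g y)) => //; exact: differentiable_cst.
exact: differentiable_inv_sub.
Qed.

Lemma slope_continuous g y : differentiable g y ->
  {for y, continuous (slope g y)}.
Proof.
move=> G; apply/(@cvg_rnP _ _ _ _ (nbhs_filter y)) => e e0.
have e20 : 0 < e / 2 by rewrite divr_gt0.
have [d d0 K] := diff_rnP G e20.
apply/nbhs_rnP; exists d => // w wd.
rewrite /slope eqxx; case: eqVneq => [_|wy]; first by rewrite subrr rn0.
have wy0 : w - y != 0 by rewrite subr_eq0.
have := K _ wd; rewrite subrK diff1_mul // => Q.
have -> : (g w - g y) / (w - y) - 'd g y (1 : C) =
   (g w - g y - 'd g y (1 : C) * (w - y)) / (w - y) by field.
rewrite rnM rnV; apply: (@le_lt_trans _ _ (e / 2)); last by lra.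
by rewrite ler_pdivrMr // rn_gt0.
Qed.

Lemma slope_cts g y z : differentiable g y -> differentiable g z ->
  {for z, continuous (slope g y)}.
Proof.
move=> Gy Gz; have [->|zy] := eqVneq z y; first exact: slope_continuous.
exact/differentiable_continuous/slope_diff.
Qed.

Definition cts_at_circle r h := forall z, rn z = r -> {for z, continuous h}.

Lemma cts_at_circleM r g h : cts_at_circle r g -> cts_at_circle r h ->
  cts_at_circle r (fun z => g z * h z).
Proof.
by move=> G H z zr; apply: (@continuousM _ _ g h); [exact: G|exact: H].
Qed.

Lemma cts_at_ckernel r y : rn y != r -> cts_at_circle r (ckernel y).
Proof.
move=> yr z zr; apply: differentiable_continuous; apply: differentiable_ckernel.
by apply: contra yr => /eqP <-; apply/eqP.
Qed.

Lemma eq_mean r g h : 0 <= r -> (forall z, rn z = r -> g z = h z) ->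
  mean r g = mean r h.
Proof. by move=> r0 E; apply: eq_avg => t; apply: E; rewrite rn_circle. Qed.

Lemma meanB r g h : 0 <= r -> cts_at_circle r g -> cts_at_circle r h ->
  mean r (fun z => g z - h z) = mean r g - mean r h.
Proof. by move=> r0 G H; exact: (avgB (cts_circle r0 G) (cts_circle r0 H)). Qed.

Lemma meanZ r (k : C) g : 0 <= r -> cts_at_circle r g ->
  mean r (fun z => k * g z) = k * mean r g.
Proof. by move=> r0 G; exact: (avgZ k (cts_circle r0 G)). Qed.

Lemma mean_bound r g M : 0 <= r -> cts_at_circle r g ->
  (forall z, rn z = r -> rn (g z) <= M) -> rn (mean r g) <= 2 * M.
Proof.
move=> r0 G H; apply: (avg_bound (cts_circle r0 G)) => t _.
by apply: H; rewrite rn_circle.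
Qed.

Lemma mean_cst r (k : C) : mean r (fun=> k) = k.
Proof. exact: avg_cst. Qed.

(** The kernel is holomorphic on the closed disc, and its factor [z] vanishes at the centre. *)
Lemma mean_ckernel_out r (y : C) : 0 < r -> r < rn y -> mean r (ckernel y) = 0.
Proof.
move=> r0 ry; have D z : rn z <= r -> differentiable (ckernel y) z.
  move=> zr; apply: differentiable_ckernel; apply: contraTneq ry => <-.
  by rewrite -leNgt.
rewrite (@mean_disc _ r (rn y) _ r0); first by rewrite /ckernel mul0r.
  by move=> z zr; apply: differentiable_continuous; exact: D.
by move=> z zr _; exact: D.
Qed.

(** Beyond [rn y] the mean does not depend on the radius, and the kernel tends to 1 at infinity;
    [r'] is large enough for [rn y / (r' - rn y) <= e / 2]. *)
Lemma mean_ckernel_in r (y : C) : rn y < r -> mean r (ckernel y) = 1.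
Proof.
move=> yr; have r0 : 0 < r := le_lt_trans (rn_ge0 y) yr.
apply/eqP; rewrite -subr_eq0; apply/eqP/eq_eps => e e0.
pose r' := rn y + r + 2 * rn y / e.
have y0 := rn_ge0 y.
have q0 : 0 <= 2 * rn y / e by rewrite divr_ge0 ?mulr_ge0 // ltW.
have rr' : r <= r' by rewrite /r'; lra.
have r'0 : 0 <= r' by lra.
have yr' : rn y < r' by lra.
rewrite (@mean_annulus _ r r' _ r0 rr'); last first.
  move=> z /andP[rz _]; apply: differentiable_ckernel.
  by apply: contraTneq rz => ->; rewrite -ltNge.
have yr'' : rn y != r' by rewrite lt_eqF.
have ck := cts_at_ckernel yr''.
have c1 : cts_at_circle r' (fun=> 1 : C) by move=> z _; exact: cst_continuous.
rewrite -[X in _ - X](mean_cst r' (1 : C)) -(meanB r'0 ck c1).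
have -> : e = 2 * (e / 2) by field.
apply: (mean_bound r'0).
  by move=> z zr; apply: (@continuousB _ _ _ (ckernel y) (fun=> 1)); [exact: ck|exact: c1].
move=> z zr; have d0 : 0 < rn (z - y).
  by apply: lt_le_trans (rn_sub _ _); rewrite zr subr_gt0.
have zy : z - y != 0 by rewrite -rn_gt0.
have -> : ckernel y z - 1 = y / (z - y) by rewrite /ckernel; field.
rewrite rnM rnV ler_pdivrMr //.
apply: le_trans (ler_wpM2l _ (rn_sub _ _)); last by rewrite divr_ge0 // ltW.
rewrite zr /r'.
have -> : e / 2 * (rn y + r + 2 * rn y / e - rn y) = e * r / 2 + rn y.
  by field; rewrite gt_eqF.
by rewrite lerDr divr_ge0 // mulr_ge0 // ltW.
Qed.

(** On the circle, [z * slope g y z] equals [(g z - g y) * ckernel y z]. The value [m] will be 0 or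
    1, according to whether [y] lies outside or inside. *)
Lemma mean_slope r g y m : 0 <= r -> rn y != r -> cts_at_circle r g ->
  mean r (ckernel y) = m ->
  mean r (fun z => z * slope g y z) = cauchy_mean r g y - g y * m.
Proof.
move=> r0 yr G <-; have ck := cts_at_ckernel yr.
have cc : cts_at_circle r (fun=> g y) by move=> z _; exact: cst_continuous.
rewrite -(meanZ (g y) r0 ck) /cauchy_mean.
rewrite -(meanB r0 (cts_at_circleM G ck) (cts_at_circleM cc ck)).
apply: (eq_mean r0) => z zr; rewrite /slope /ckernel.
have zy : z != y by apply: contra yr => /eqP <-; apply/eqP.
by rewrite (negbTE zy); field; rewrite subr_eq0.
Qed.

(** The function [z * slope g y z] is continuous on the disc, holomorphic off the circle through
    [y], and 0 at the centre, so its mean is 0. *)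
Lemma cauchy_disc r g y : rn y < r -> (forall z, rn z <= r -> differentiable g z) ->
  cauchy_mean r g y = g y.
Proof.
move=> yr G; have r0 : 0 < r := le_lt_trans (rn_ge0 y) yr.
have yr' : rn y != r by rewrite lt_eqF.
have cg : cts_at_circle r g.
  by move=> z zr; apply/differentiable_continuous/G; rewrite zr.
have := mean_slope (ltW r0) yr' cg (mean_ckernel_in yr); rewrite mulr1 => E.
apply/eqP; rewrite -subr_eq0 -E; apply/eqP.
rewrite -[RHS](mul0r (slope g y 0)).
apply: (@mean_disc _ r (rn y) (fun z => z * slope g y z) r0) => z zr.
  apply: (@continuousM _ _ id (slope g y)); first exact: cvg_id.
  by apply: slope_cts; [exact/G/ltW|exact: G].
move=> zy; apply: (@differentiableM _ _ id (slope g y)); first exact: differentiable_idC.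
by apply: slope_diff; [apply: contra zy => /eqP ->|exact: G].
Qed.

(** The mean of [z * slope g y z] is the same on both circles; [mean_slope] evaluates it with
    [m = 0] on the inner and [m = 1] on the outer one. *)
Lemma laurent r1 r2 g y : 0 < r1 -> r1 < rn y -> rn y < r2 ->
  (forall z, r1 <= rn z <= r2 -> differentiable g z) ->
  cauchy_mean r2 g y - cauchy_mean r1 g y = g y.
Proof.
move=> r10 r1y yr2 G.
have r20 : 0 < r2 by apply: lt_trans yr2; apply: lt_trans r1y.
have r12 : r1 <= r2 by apply/ltW/(lt_trans r1y).
have yr1 : rn y != r1 by rewrite gt_eqF.
have yr2' : rn y != r2 by rewrite lt_eqF.
have c1 : cts_at_circle r1 g.
  by move=> z zr; apply/differentiable_continuous/G; rewrite zr lexx r12.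
have c2 : cts_at_circle r2 g.
  by move=> z zr; apply/differentiable_continuous/G; rewrite zr lexx r12.
have Gy : differentiable g y by apply: G; rewrite !ltW.
have E1 := mean_slope (ltW r10) yr1 c1 (mean_ckernel_out r10 r1y).
have E2 := mean_slope (ltW r20) yr2' c2 (mean_ckernel_in yr2).
have : mean r1 (fun z => z * slope g y z) = mean r2 (fun z => z * slope g y z).
  apply: (@mean_annulus_except _ r1 r2 (rn y) _ r10 r12) => z zr.
    apply: (@continuousM _ _ id (slope g y)); first exact: cvg_id.
    by apply: slope_cts; [exact: Gy|exact: G].
  move=> zy; apply: (@differentiableM _ _ id (slope g y)); first exact: differentiable_idC.
  by apply: slope_diff; [apply: contra zy => /eqP ->|exact: G].
move=> E; have := etrans (etrans (esym E1) E) E2; rewrite mulr0 subr0 mulr1 => ->.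
exact: subKr.
Qed.

(** Integrate [z / (z - t) - 1 - t / z = t ^+ 2 / (z * (z - t))] against [g]. The right-hand side is
    at most [rn t ^+ 2 / (T * (T / 2))], and [mean_bound] costs another factor 2. *)
Lemma second_order_cauchy g T M t : 0 < T ->
  (forall z, rn z <= T -> differentiable g z) ->
  (forall z, rn z = T -> rn (g z) <= M) -> rn t <= T / 2 ->
  rn (g t - g 0 - mean T (fun z => g z / z) * t) <= 4 * M * rn t ^+ 2 / T ^+ 2.
Proof.
move=> T0 G B tT.
have tT' : rn t < T by lra.
have cg : cts_at_circle T g.
  by move=> z zr; apply/differentiable_continuous/G; rewrite zr.
have M0 : 0 <= M by apply: le_trans (B (rc T) _); rewrite ?rn_ge0 // rn_rc gtr0_norm.
have cV : cts_at_circle T (fun z : C => z^-1).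
  move=> z zr; have -> : (fun z : C => z^-1) = (fun z : C => (z - 0)^-1).
    by apply/funext => w; rewrite subr0.
  apply/differentiable_continuous/differentiable_inv_sub.
  by rewrite -rn_gt0 zr.
have tnT : rn t != T by rewrite lt_eqF.
have ck := cts_at_ckernel tnT.
have c1 := cts_at_circleM cg ck.
have c2 := cts_at_circleM cg cV.
have c3 : cts_at_circle T (fun z => t * (g z / z)).
  have ct : cts_at_circle T (fun=> t) by move=> z _; exact: cst_continuous.
  exact: (cts_at_circleM ct c2).
have c4 : cts_at_circle T (fun z => g z * ckernel t z - g z).
  by move=> z zr; apply: (@continuousB _ _ _ (fun z => g z * ckernel t z) g);
    [exact: c1|exact: cg].
have -> : g t - g 0 - mean T (fun z => g z / z) * t =
    mean T (fun z => g z * ckernel t z - g z - t * (g z / z)).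
  have T0' := ltW T0.
  rewrite (meanB T0' c4 c3) (meanB T0' c1 cg) (meanZ t T0' c2).
  rewrite -/(cauchy_mean T g t) (cauchy_disc tT' G) [mean _ _ * t]mulrC.
  rewrite (@mean_disc _ T (- 1) g T0) // => z zT.
    exact/differentiable_continuous/G.
  by move=> _; exact: G.
have -> : 4 * M * rn t ^+ 2 / T ^+ 2 = 2 * (2 * M * rn t ^+ 2 / T ^+ 2) by ring.
apply: (mean_bound (ltW T0)).
  move=> z zr; apply: (@continuousB _ _ _ (fun z => g z * ckernel t z - g z) (fun z => t * (g z
    / z))).
    exact: c4.
  exact: c3.
move=> z zr; have d0 : T / 2 <= rn (z - t).
  by apply: le_trans (rn_sub _ _); rewrite zr; lra.
have zt : z - t != 0 by rewrite -rn_gt0; lra.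
have z0 : z != 0 by rewrite -rn_gt0 zr.
have -> : g z * ckernel t z - g z - t * (g z / z) = g z * (t ^+ 2 / (z * (z - t))).
  by rewrite /ckernel; field; rewrite zt z0.
rewrite rnM rnM rnV rnX rnM zr.
have -> : 2 * M * rn t ^+ 2 / T ^+ 2 = M * (rn t ^+ 2 / (T * (T / 2))).
  by field; rewrite gt_eqF.
apply: ler_pM => //; try exact: rn_ge0.
  by rewrite divr_ge0 ?sqr_ge0 // mulr_ge0 ?rn_ge0 // ltW.
  exact: B.
rewrite ler_wpM2l ?sqr_ge0 // lef_pV2 ?posrE; first by rewrite ler_wpM2l // ltW.
  by rewrite mulr_gt0 //; lra.
by rewrite mulr_gt0 //; lra.
Qed.

(** The mean of [g z / z] and the derivative are both first-order coefficients of [g] at 0, one with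
    a quadratic error and the other with error [o(rn t)], so they coincide. *)
Lemma second_order g T M t : 0 < T ->
  (forall z, rn z <= T -> differentiable g z) ->
  (forall z, rn z = T -> rn (g z) <= M) -> rn t <= T / 2 ->
  rn (g t - g 0 - 'd g 0 (1 : C) * t) <= 4 * M * rn t ^+ 2 / T ^+ 2.
Proof.
move=> T0 G B tT.
suff <- : mean T (fun z => g z / z) = 'd g 0 (1 : C).
  exact: (second_order_cauchy T0 G B tT).
set A := mean _ _; set l := 'd g _ _.
have M0 : 0 <= M by apply: le_trans (B (rc T) _); rewrite ?rn_ge0 // rn_rc gtr0_norm.
have G0 : differentiable g 0 by apply: G; rewrite rn0 ltW.
apply/eqP; rewrite -subr_eq0; apply/eqP/eq_eps => e e0.
have e20 : 0 < e / 2 by rewrite divr_gt0.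
have [d d0 K] := diff_rnP G0 e20.
pose K' := 4 * M / T ^+ 2.
have K'0 : 0 <= K' by rewrite /K' divr_ge0 // ?mulr_ge0 // ?exprn_ge0 // ltW.
pose s := Num.min (Num.min (d / 2) (T / 2)) (e / 2 / (K' + 1)).
have K1 : 0 < K' + 1 by rewrite ltr_wpDl.
have s0 : 0 < s by rewrite !lt_min !divr_gt0.
have sd : s <= d / 2 by rewrite !ge_min lexx.
have sT : s <= T / 2 by rewrite !ge_min lexx orbT.
have se : s * (K' + 1) <= e / 2 by rewrite -ler_pdivlMr // !ge_min lexx !orbT.
have rs : rn (rc s : C) = s by rewrite rn_rc gtr0_norm.
have k1 : rn (rc s : C) < d by rewrite rs; lra.
have := K _ k1; rewrite addr0 diff1_mul // -/l => h1.
have k2 : rn (rc s : C) <= T / 2 by rewrite rs.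
have := second_order_cauchy T0 G B k2; rewrite -/A => h2.
have : rn ((A - l) * rc s) <= e / 2 * s + K' * s * s.
  have -> : (A - l) * rc s = (g (rc s) - g 0 - l * rc s) - (g (rc s) - g 0 - A * rc s) by ring.
  apply: le_trans (rnB _ _) _; apply: lerD; first by move: h1; rewrite rs.
  by move: h2; rewrite rs /K' => h2; apply: le_trans h2 _; rewrite le_eqVlt; apply/orP; left;
    apply/eqP; ring.
rewrite rnM rs -mulrDl ler_pM2r // => h; apply: le_trans h _.
by lra.
Qed.

End Cauchy.

(** * Holomorphic dependence on parameters *)

Section ParamIntegral.
Variable R : realType.
Local Notation C := (CC R).
Variable V : normedModType C.

Lemma differentiable_line (v h : V) (z : C) :
  differentiable (fun z : C => z *: h + v) z.
Proof.
apply: (@differentiableD _ _ _ (fun z : C => z *: h) (fun=> v)); last exact: differentiable_cst.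
exact: (@differentiableZl _ _ _ (id : C -> C) h).
Qed.

Lemma diff_line (f : V -> C) (v h : V) : differentiable f v ->
  'd (fun z : C => f (z *: h + v)) 0 (1 : C) = 'd f v h.
Proof.
move=> F.
have E : (0 : C) *: h + v = v by rewrite scale0r add0r.
have D := differentiable_line v h 0.
have F' : differentiable f ((0 : C) *: h + v) by rewrite E.
have DF : differentiable (fun z : C => f (z *: h + v)) 0.
  exact: (@differentiable_comp _ _ _ _ (fun z : C => z *: h + v) f).
rewrite -(deriveE (1 : C) DF) -(deriveE h F) /derive;
match goal with |- _ (_ ?u _) = _ (_ ?w _) => suff -> : u = w by [] end.
apply/funext => z /=; rewrite scale0r add0r addr0.
by rewrite -[z *: 1]/(z * 1) mulr1.
Qed.

(** Restrict to the complex line [z *: h + v]: the disc of radius [T = rho / 2 / rn h] stays in the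
    ball, and [z = 1] lies in its inner half exactly when [rn h <= rho / 4]. The remainder involves
    only a bound on [f], hence is uniform in parameters. *)
Lemma second_order_vec (f : V -> C) (v h : V) (rho M : R) : 0 < rho ->
  (forall w, rn (w - v) < rho -> differentiable f w) ->
  (forall w, rn (w - v) < rho -> rn (f w) <= M) -> rn h <= rho / 4 ->
  rn (f (h + v) - f v - 'd f v h) <= 16 * M / rho ^+ 2 * rn h ^+ 2.
Proof.
move=> rho0 F B hr.
have [->|h0] := eqVneq h 0.
  by rewrite add0r subrr linear0 subrr !rn0 expr0n /= mulr0.
have nh : 0 < rn h by rewrite rn_gt0.
pose T := rho / 2 / rn h.
have T0 : 0 < T by rewrite !divr_gt0.
have in_ball (z : C) : rn z <= T -> rn (z *: h + v - v) < rho.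
  move=> zT; rewrite addrK rnZ; apply: (@le_lt_trans _ _ (rho / 2)); last by lra.
  by rewrite -ler_pdivlMr.
pose g (z : C) := f (z *: h + v).
have G z : rn z <= T -> differentiable g z.
  move=> zT; apply: (@differentiable_comp _ _ _ _ (fun z : C => z *: h + v) f).
    exact: differentiable_line.
  exact/F/in_ball.
have GB z : rn z = T -> rn (g z) <= M.
  by move=> zT; apply/B/in_ball; rewrite zT.
have T1 : rn (1 : C) <= T / 2.
  rewrite rn1 /T ler_pdivlMr // mul1r ler_pdivlMr //; lra.
have := second_order T0 G GB T1.
rewrite /g scale1r scale0r add0r diff_line ?mulr1; last by apply: F; rewrite subrr rn0.
rewrite rn1 expr1n mulr1 => H; apply: le_trans H _; rewrite le_eqVlt; apply/orP; left; apply/eqP.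
by rewrite /T; field; rewrite !gt_eqF.
Qed.

Local Notation p2 := (2 * (pi : R)).

(** A uniform bound on [K] gives, by [second_order_vec], a quadratic remainder uniform in [t], which
    is then averaged. The range of [t] exceeds the period because [cts_on] is two-sided at the end
    points. *)
Lemma differentiable_avg (K : V -> R -> C) (v0 : V) (rho M : R) : 0 < rho ->
  (forall v t, rn (v - v0) < rho -> -1 < t < p2 + 1 -> differentiable (K^~ t) v) ->
  (forall v, rn (v - v0) < rho -> cts_on 0 p2 (K v)) ->
  (forall v t, rn (v - v0) < rho -> -1 < t < p2 + 1 -> rn (K v t) <= M) ->
  differentiable (fun v => avg (K v)) v0.
Proof.
move=> rho0 D Kc B.
have p20 := pi2_gt0 R.
have tin t : 0 <= t <= p2 -> -1 < t < p2 + 1.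
  by move=> /andP[t0 t2]; apply/andP; split; lra.
have t00 : (0 : R) <= 0 <= p2 by rewrite lexx ltW.
have v00 : rn (v0 - v0) < rho by rewrite subrr rn0.
have M0 : 0 <= M by apply: le_trans (B v0 0 v00 (tin _ t00)); exact: rn_ge0.
pose dK h t := 'd (K^~ t) v0 h.
pose c := 16 * M / rho ^+ 2.
have c0 : 0 <= c by rewrite divr_ge0 ?exprn_ge0 ?mulr_ge0 // ltW.
have est h t : rn h <= rho / 4 -> -1 < t < p2 + 1 ->
    rn (K (h + v0) t - K v0 t - dK h t) <= c * rn h ^+ 2.
  move=> hr ht; apply: (@second_order_vec (K^~ t)) => // w wr.
    exact: D.
  exact: B.
have dKZ (a : C) h t : dK (a *: h) t = a * dK h t by rewrite /dK linearZ.
have alg (a k1 k2 k3 k4 d1 d2 : C) : a * (d1 - d2) =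
    (k1 - k2) - (k3 - k4) - (k1 - k3 - a * d1) + (k2 - k4 - a * d2) by ring.
have alg2 (k1 k2 d : C) : d = (k1 - k2) - (k1 - k2 - d) by ring.
(* The derivative in direction [h] is a uniform limit of difference quotients that are continuous in
   [t]: the step [s] is fixed so that each of the two remainders is at most [s * e / 4], and only
   then does [t'] approach [t]. *)
have dKc h : cts_on 0 p2 (dK h).
  move=> t ht; apply/(@cvg_rnP _ _ _ _ (nbhs_filter t)) => e e0.
  pose s := Num.min (rho / 4 / (rn h + 1)) (e / 4 / (c * rn h ^+ 2 + 1)).
  have h1 : 0 < rn h + 1 by rewrite ltr_wpDl // rn_ge0.
  have h2 : 0 < c * rn h ^+ 2 + 1 by rewrite ltr_wpDl // mulr_ge0 // sqr_ge0.
  have s0 : 0 < s by rewrite lt_min !divr_gt0.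
  have s1 : s * (rn h + 1) <= rho / 4 by rewrite -ler_pdivlMr // ge_min lexx.
  have s2 : s * (c * rn h ^+ 2 + 1) <= e / 4 by rewrite -ler_pdivlMr // ge_min lexx orbT.
  have rs : rn (rc s : C) = s by rewrite rn_rc gtr0_norm.
  have rsh : rn ((rc s : C) *: h) = s * rn h by rewrite rnZ rs.
  have shr : rn ((rc s : C) *: h) <= rho / 4 by rewrite rsh; have := rn_ge0 h; nra.
  have shr' : rn ((rc s : C) *: h + v0 - v0) < rho by rewrite addrK; lra.
  have C1 := Kc _ shr' t ht; have C2 := Kc _ v00 t ht.
  have es : 0 < e * s / 4 by rewrite !(mulr_gt0, divr_gt0).
  have /(@cvg_rnP _ _ _ _ (nbhs_filter t))/(_ _ es) N1 := C1.
  have /(@cvg_rnP _ _ _ _ (nbhs_filter t))/(_ _ es) N2 := C2.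
  have N3 : \forall t' \near t, -1 < t' < p2 + 1.
    apply/nbhs_ballP; exists 1 => //= t'; rewrite -ball_normE /= ltr_norml.
    by move: ht => /andP[? ?] /andP[? ?]; apply/andP; split; lra.
  near=> t'.
  have n1 : rn (K (rc s *: h + v0) t' - K (rc s *: h + v0) t) < e * s / 4 by near: t'.
  have n2 : rn (K v0 t' - K v0 t) < e * s / 4 by near: t'.
  have n3 : -1 < t' < p2 + 1 by near: t'.
  have E1 := est _ _ shr n3; have E2 := est _ _ shr (tin _ ht).
  rewrite rsh in E1 E2.
  have : rn (rc s * (dK h t' - dK h t)) < s * e.
    have -> : rc s * (dK h t' - dK h t) =
      (K (rc s *: h + v0) t' - K (rc s *: h + v0) t) - (K v0 t' - K v0 t)
      - (K (rc s *: h + v0) t' - K v0 t' - dK (rc s *: h) t')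
      + (K (rc s *: h + v0) t - K v0 t - dK (rc s *: h) t).
      rewrite (dKZ _ h t) (dKZ _ h t'); exact: alg.
    have q : c * (s * rn h) ^+ 2 <= s * (e / 4).
      have -> : c * (s * rn h) ^+ 2 = s * (s * (c * rn h ^+ 2)) by ring.
      apply: (ler_wpM2l (ltW s0)); apply: (le_trans _ s2).
      by apply: (ler_wpM2l (ltW s0)); rewrite lerDl ler01.
    apply: le_lt_trans (rnD _ _) _.
    have -> : s * e = e * s / 4 + e * s / 4 + s * (e / 4) + s * (e / 4) by field.
    apply: ltr_leD; last exact: (le_trans E2 q).
    apply: le_lt_trans (rnB _ _) _; apply: ltr_leD; last exact: (le_trans E1 q).
    by apply: le_lt_trans (rnB _ _) _; exact: ltrD.
  by rewrite rnM rs ltr_pM2l.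
(* Along [h] rescaled to length [rho / 4], the increment of [K] is at most [2 * M] and the remainder
   at most [M]; scaling back turns [3 * M] into [12 * M / rho * rn h]. *)
have dKb h t : 0 <= t <= p2 -> rn (dK h t) <= 12 * M / rho * rn h.
  move=> ht; have [->|h0] := eqVneq h 0; first by rewrite /dK linear0 !rn0 mulr0.
  have nh : 0 < rn h by rewrite rn_gt0.
  pose s := rho / 4 / rn h.
  have s0 : 0 < s by rewrite !divr_gt0.
  have rs : rn (rc s : C) = s by rewrite rn_rc gtr0_norm.
  have rsh : rn ((rc s : C) *: h) = rho / 4 by rewrite rnZ rs /s divfK // gt_eqF.
  have shr : rn ((rc s : C) *: h) <= rho / 4 by rewrite rsh.
  have shr' : rn ((rc s : C) *: h + v0 - v0) < rho by rewrite addrK; lra.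
  have E1 := est _ _ shr (tin _ ht); rewrite rsh in E1.
  have b1 := B _ _ shr' (tin _ ht); have b2 := B _ _ v00 (tin _ ht).
  have cE : c * (rho / 4) ^+ 2 = M by rewrite /c; field; rewrite gt_eqF.
  have : rn (dK (rc s *: h) t) <= 3 * M.
    have -> : dK (rc s *: h) t = (K (rc s *: h + v0) t - K v0 t) - (K (rc s *: h + v0) t - K v0
      t - dK (rc s *: h) t) by exact: alg2.
    apply: le_trans (rnB _ _) _.
    have -> : 3 * M = (M + M) + M by ring.
    apply: lerD; first by apply: le_trans (rnB _ _) _; exact: lerD.
    by rewrite -cE.
  rewrite dKZ rnM rs mulrC -ler_pdivlMr // => H; apply: le_trans H _.
  rewrite le_eqVlt; apply/orP; left; apply/eqP; rewrite /s; field.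
  by rewrite !gt_eqF.
apply: (@linear_rnP_diff R V C (fun v => avg (K v)) v0 (fun h => avg (dK h)) (2 * (12 * M /
  rho))).
- move=> a x y; rewrite /GRing.scale /= -(avgZ a (dKc x)).
  rewrite -(avgD (cts_onM (@cts_on_cst _ _ _ a) (dKc x)) (dKc y)).
  by apply: eq_avg => t; rewrite /dK linearP.
- move=> h; rewrite -mulrA; apply: (avg_bound (dKc h)) => t; exact: dKb.
move=> e e0; exists (Num.min (rho / 4) (e / (2 * c + 1))).
  by rewrite lt_min !divr_gt0 // ltr_wpDl // mulr_ge0.
move=> h; rewrite lt_min => /andP[/ltW h1 h2].
have hr' : rn (h + v0 - v0) < rho by rewrite addrK; lra.
rewrite -(avgB (Kc _ hr') (Kc _ v00)) -(avgB (cts_onB (Kc _ hr') (Kc _ v00)) (dKc h)).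
apply: (@le_trans _ _ (2 * (c * rn h ^+ 2))).
  apply: avg_bound; first exact: (cts_onB (cts_onB (Kc _ hr') (Kc _ v00)) (dKc h)).
  by move=> t ht; apply: est => //; exact: tin.
have := rn_ge0 h; move: h2; rewrite ltr_pdivlMr; last by rewrite ltr_wpDl // mulr_ge0.
move=> h2 h0; have -> : 2 * (c * rn h ^+ 2) = rn h * (2 * c) * rn h by ring.
rewrite ler_wpM2r //; lra.
Unshelve. all: by end_near. Qed.

End ParamIntegral.

Section MeanDiff.
Variable R : realType.
Local Notation C := (CC R).
Variable V : normedModType C.

Lemma bounded_on_itv (u : R -> C) (a b : R) : a <= b -> cts_on a b u ->
  exists M, forall t, a <= t <= b -> rn (u t) <= M.
Proof.
move=> ab U.
have [|t _ H] := @EVT_max R (fun t => rn (u t)) a b ab.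
  apply: continuous_in_subspaceT => t; rewrite inE /= in_itv /= => tab.
  apply: (@continuous_comp _ _ _ u (@rn R C)); first exact: U.
  exact: continuous_rn.
by exists (rn (u t)) => s sab; apply: H; rewrite in_itv.
Qed.

(** The bound required by [differentiable_avg] comes from compactness: [K v0] is bounded on the
    enlarged interval, and [K v] stays within 1 of it for [v] near [v0]. *)
Lemma differentiable_mean (F : V -> C -> C) (v0 : V) (r : R) : 0 <= r ->
  (forall z, rn z = r -> {for (v0, z), continuous (fun p : V * C => F p.1 p.2)}) ->
  (\forall v \near v0, forall z, rn z = r ->
     differentiable (F^~ z) v /\ {for z, continuous (F v)}) ->
  differentiable (fun v => mean r (F v)) v0.
Proof.
move=> r0 J N.
have p20 := pi2_gt0 R.
pose K v t := F v (rc r * cis t).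
have rc_ t : rn (rc r * cis t : C) = r by exact: rn_circle.
have Jt t : {for (v0, t), continuous (fun p : V * R => K p.1 p.2)}.
  apply: (@continuous_comp _ _ _ (fun p : V * R => (p.1, rc r * cis p.2 : C))
    (fun p : V * C => F p.1 p.2)); last exact: J.
  have cs : (rc r * cis p.2 : C) @[p --> (v0, t)] --> (rc r * cis t : C).
    apply: cvgM; first exact: cvg_cst.
    have c1 : p.2 @[p --> (v0, t)] --> t by exact: cvg_snd.
    exact: (cvg_comp _ _ c1 (@continuous_cis R t)).
  exact: (@cvg_pair _ _ _ _ (nbhs v0) (nbhs (rc r * cis t : C)) _ _ _ fst _ cvg_fst cs).
have ab : -1 <= 2 * (pi : R) + 1 by lra.
have [M HM] : exists M, forall t, -1 <= t <= 2 * (pi : R) + 1 -> rn (K v0 t) <= M.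
  apply: bounded_on_itv ab _ => t _.
  apply: (@continuous_comp _ _ _ (fun t : R => rc r * cis t) (F v0)).
    by apply: cvgM; [exact: cvg_cst|exact: continuous_cis].
  by have [] := nbhs_singleton N _ (rc_ t).
have U := @unif_near R V v0 K (-1) (2 * pi + 1) (fun t _ => Jt t) 1 ltr01.
have /nbhs_rnP[rho rho0 H] : \forall v \near v0, (forall z, rn z = r ->
     differentiable (F^~ z) v /\ {for z, continuous (F v)}) /\
     (forall t, -1 <= t <= 2 * pi + 1 -> rn (K v t - K v0 t) < 1).
  by apply: filterS2 N U.
apply: (@differentiable_avg R V K v0 rho (M + 1) rho0).
- by move=> v t vr _; have [] := (H v vr).1 _ (rc_ t).
- move=> v vr; apply: (cts_circle r0) => z zr; by have [] := (H v vr).1 z zr.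
move=> v t vr /andP[t1 t2].
have t12 : -1 <= t <= 2 * pi + 1 by rewrite !ltW.
rewrite -(subrK (K v0 t) (K v t)) addrC; apply: le_trans (rnD _ _) _.
by apply: lerD; [exact: HM|exact/ltW/((H v vr).2 t t12)].
Qed.
End MeanDiff.

(** * Coordinates, the indefinite form and its cone *)

Definition co (R : realType) n (v : Cn R n) (k : 'I_n) : CC R := v ord0 k.
Definition ev (R : realType) n (k : 'I_n) : Cn R n := delta_mx ord0 k.
(** Written as an affine line in [z], so that replacing a coordinate falls under
    [differentiable_line]. *)
Definition upd (R : realType) n (v : Cn R n) (i : 'I_n) (z : CC R) : Cn R n :=
  z *: ev R i + (v - co v i *: ev R i).
Definition sg (R : realType) n (S : {set 'I_n}) (k : 'I_n) : R :=
  if k \in S then 1 else -1.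
Definition Hf (R : realType) n (S : {set 'I_n}) (v : Cn R n) : R :=
  \sum_k sg R S k * rn (co v k) ^+ 2.
(* The cone [sum_(k in S) |v_k|^2 > sum_(k notin S) |v_k|^2]. *)
Definition Om (R : realType) n (S : {set 'I_n}) : set (Cn R n) :=
  [set v | 0 < Hf S v].

Section Coord.
Variables (R : realType) (n : nat).
Local Notation C := (CC R).
Local Notation V := (Cn R n).
Implicit Types (v w : V) (S : {set 'I_n}) (i k : 'I_n) (z : C).

Lemma coD v w k : co (v + w) k = co v k + co w k.
Proof. by rewrite /co mxE. Qed.
Lemma coN v k : co (- v) k = - co v k.
Proof. by rewrite /co mxE. Qed.
Lemma coZ (a : C) v k : co (a *: v) k = a * co v k.
Proof. by rewrite /co mxE. Qed.
Lemma co_ev i k : co (ev R i) k = (k == i)%:R.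
Proof. by rewrite /co /ev mxE eqxx. Qed.
Lemma co0 k : co (0 : V) k = 0.
Proof. by rewrite /co mxE. Qed.
Lemma coP v w : (forall k, co v k = co w k) -> v = w.
Proof. by move=> E; apply/rowP => k; exact: E. Qed.

Lemma co_upd v i z k : co (upd v i z) k = if k == i then z else co v k.
Proof.
rewrite /upd coD coD coN !coZ co_ev; case: eqP => [->|_].
  by rewrite !mulr1 subrr addr0.
by rewrite !mulr0 subr0 add0r.
Qed.

Lemma upd_id v i : upd v i (co v i) = v.
Proof. by apply: coP => k; rewrite co_upd; case: eqP => [->|]. Qed.

Lemma differentiable_co k v : differentiable (fun w : V => co w k) v.
Proof. exact: differentiable_coord. Qed.

Lemma continuous_co k : continuous (fun w : V => co w k).
Proof. by move=> v; apply: differentiable_continuous; exact: differentiable_co. Qed.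

Lemma differentiable_upd_z v i z : differentiable (upd v i) z.
Proof. exact: differentiable_line. Qed.

Lemma differentiable_upd_v i z v : differentiable (fun w : V => upd w i z) v.
Proof.
apply: (@differentiableD _ _ _ (fun=> z *: ev R i) (fun w : V => w - co w i *: ev R i)).
  exact: differentiable_cst.
apply: (@differentiableB _ _ _ id (fun w : V => co w i *: ev R i)); first by [].
apply: (@differentiableZl _ _ _ (fun w : V => co w i) (ev R i)).
exact: differentiable_co.
Qed.

Lemma continuous_upd i : continuous (fun p : V * C => upd p.1 i p.2).
Proof.
move=> [v z]; rewrite /upd; apply: cvgD.
  by apply: cvgZr_tmp; exact: cvg_snd.
apply: cvgB; first exact: cvg_fst.
apply: cvgZr_tmp.
by apply: (@continuous_comp _ _ _ fst (fun w : V => co w i));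
  [exact: cvg_fst|exact: continuous_co].
Qed.

Lemma differentiable_row (F : V -> V) v :
  (forall k, differentiable (fun w => co (F w) k) v) -> differentiable F v.
Proof.
move=> H.
have -> : F = \sum_(k < n) (fun w => co (F w) k *: ev R k).
  apply/funext => w; rewrite fct_sumE; apply: coP => k.
  rewrite /co summxE (bigD1 k) //= big1 => [|j jk].
    by rewrite !mxE !eqxx mulr1 addr0.
  by rewrite !mxE eqxx /= eq_sym (negbTE jk) mulr0.
apply: differentiable_sum => k.
exact: (@differentiableZl _ _ _ (fun w => co (F w) k) (ev R k)).
Qed.

Lemma sg_in S k : k \in S -> sg R S k = 1. Proof. by rewrite /sg => ->. Qed.

Lemma Hf_upd S v i z : i \in S ->
  Hf S (upd v i z) = Hf S v - rn (co v i) ^+ 2 + rn z ^+ 2.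
Proof.
move=> iS; rewrite /Hf (bigD1 i) //= [in RHS](bigD1 i) //= co_upd eqxx sg_in //.
rewrite !mul1r (eq_bigr (fun k => sg R S k * rn (co v k) ^+ 2)); last first.
  by move=> k /negbTE ki; rewrite co_upd ki.
by ring.
Qed.

Lemma continuous_Hf S : continuous (@Hf R n S).
Proof.
have H k : continuous (fun w : V => sg R S k * rn (co w k) ^+ 2).
  move=> v; apply: (@continuousM R V (fun=> sg R S k) (fun w => rn (co w k) ^+ 2) v).
    exact: cst_continuous.
  apply: (@continuous_comp _ _ _ (fun w : V => rn (co w k)) (fun x : R => x ^+ 2)).
    apply: (@continuous_comp _ _ _ (fun w : V => co w k) (@rn R C)).
      exact: continuous_co.
    exact: continuous_rn.
  exact: exprn_continuous.
rewrite /Hf; apply: (@continuous_big R _ +%R) => [|k _]; last exact: H.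
exact: add_continuous.
Qed.

Lemma open_Om S : open (@Om R n S).
Proof.
have -> : Om S = @Hf R n S @^-1` [set x | 0 < x] by [].
by apply: open_comp => [v _|]; [exact: continuous_Hf|exact: open_gt].
Qed.

End Coord.

(** * Hartogs extension *)

(** For [i] in [S], the part of the form that does not see the [i]-th coordinate: [upd v i z] is in
    the cone iff [Hr S i v + rn z ^+ 2] is positive. *)
Definition Hr (R : realType) n (S : {set 'I_n}) (i : 'I_n) (v : Cn R n) : R :=
  Hf S v - rn (co v i) ^+ 2.
(** An explicit radius, available for every [v], whose circle encloses [co v i] and lies in the
    cone. *)
Definition rad (R : realType) n (S : {set 'I_n}) (i : 'I_n) (v : Cn R n) : R :=
  rn (co v i) + `|Hr S i v| + 1.
Definition ext (R : realType) n (S : {set 'I_n}) (i : 'I_n) (f : Cn R n -> CC R)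
  (v : Cn R n) : CC R := cauchy_mean (rad S i v) (fun z => f (upd v i z)) (co v i).

Section Hartogs.
Variables (R : realType) (n : nat) (S : {set 'I_n}) (i j : 'I_n).
Hypotheses (iS : i \in S) (jS : j \in S) (ij : i != j).
Local Notation C := (CC R).
Local Notation V := (Cn R n).
Local Notation Om := (@Om R n S).
Local Notation Hr := (Hr S).
Implicit Types (v w : V) (z : C) (r : R).

Lemma upd_Om v z : 0 < Hr i v + rn z ^+ 2 -> Om (upd v i z).
Proof. by rewrite /Om /= Hf_upd. Qed.

Lemma rad_gt v : rn (co v i) < rad S i v.
Proof. by rewrite /rad; have := normr_ge0 (Hr i v); lra. Qed.

Lemma rad_gt0 v : 0 < rad S i v.
Proof. exact: le_lt_trans (rn_ge0 _) (rad_gt v). Qed.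

Lemma rad_good v : 0 < Hr i v + rad S i v ^+ 2.
Proof.
have h1 := normr_ge0 (Hr i v); have h2 := rn_ge0 (co v i).
have h3 := ler_norm (- Hr i v); rewrite normrN in h3.
rewrite /rad; nra.
Qed.

Lemma good_mono v r1 r2 : 0 <= r1 -> r1 <= r2 -> 0 < Hr i v + r1 ^+ 2 ->
  0 < Hr i v + r2 ^+ 2.
Proof.
move=> r10 r12 H; apply: lt_le_trans H _.
by rewrite lerD2l ler_sqr // nnegrE (le_trans r10).
Qed.

Section Fun.
Variable f : V -> C.
Hypothesis fd : forall v, Om v -> differentiable f v.

Lemma diff_f_upd v z : 0 < Hr i v + rn z ^+ 2 ->
  differentiable (fun z => f (upd v i z)) z.
Proof.
move=> H; apply: (@differentiable_comp _ _ _ _ (upd v i) f).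
  exact: differentiable_upd_z.
exact/fd/upd_Om.
Qed.

(** Once a circle in the [i]-th variable lies in the cone, so do all larger ones, and enlarging it
    meets no singularity. *)
Lemma cauchy_indep v r1 r2 : rn (co v i) < r1 -> r1 <= r2 ->
  0 < Hr i v + r1 ^+ 2 ->
  cauchy_mean r1 (fun z => f (upd v i z)) (co v i) =
  cauchy_mean r2 (fun z => f (upd v i z)) (co v i).
Proof.
move=> yr r12 H.
have r10 : 0 < r1 := le_lt_trans (rn_ge0 _) yr.
apply: (mean_annulus r10 r12) => z /andP[rz _].
apply: (@differentiableM _ _ (fun z => f (upd v i z)) (ckernel (co v i))).
  by apply: diff_f_upd; exact: good_mono (ltW r10) rz H.
by apply: differentiable_ckernel; apply: contraTneq rz => ->; rewrite -ltNge.
Qed.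

Lemma continuous_f v : Om v -> {for v, continuous f}.
Proof. by move=> /fd; exact: differentiable_continuous. Qed.

Lemma continuous_f_upd v z : Om (upd v i z) ->
  {for (v, z), continuous (fun p : V * C => f (upd p.1 i p.2))}.
Proof.
move=> H; apply: (@continuous_comp _ _ _ (fun p : V * C => upd p.1 i p.2) f).
  exact: continuous_upd.
exact: continuous_f.
Qed.

Lemma continuous_co_rn : continuous (fun v : V => rn (co v i)).
Proof.
move=> v; apply: (@continuous_comp _ _ _ (fun w : V => co w i) (@rn R C)).
  exact: continuous_co.
exact: continuous_rn.
Qed.

Lemma continuous_Hr : continuous (Hr i : V -> R).
Proof.
move=> v; apply: (@continuousB R R V (@Hf R n S) (fun w => rn (co w i) ^+ 2) v).
  exact: continuous_Hf.
apply: (@continuous_comp _ _ _ (fun w : V => rn (co w i)) (fun x : R => x ^+ 2)).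
  exact: continuous_co_rn.
exact: exprn_continuous.
Qed.

Lemma near_good v0 r : rn (co v0 i) < r -> 0 < Hr i v0 + r ^+ 2 ->
  \forall v \near v0, rn (co v i) < r /\ 0 < Hr i v + r ^+ 2.
Proof.
move=> h1 h2.
have N1 : \forall v \near v0, rn (co v i) < r.
  have := @continuous_co_rn v0; move/cvgr_lt; exact.
have N2 : \forall v \near v0, - r ^+ 2 < Hr i v.
  have := @continuous_Hr v0; move/cvgr_gt; apply; lra.
by apply: filterS2 N1 N2 => v ? ?; split=> //; lra.
Qed.

(** The radius [rad S i v] varies with [v] through absolute values. Near [v0] it can be frozen at
    its value there by [cauchy_indep], after which [differentiable_mean] applies with the whole
    vector as parameter. *)
Lemma ext_diff v0 : differentiable (ext S i f) v0.
Proof.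
pose r := rad S i v0.
have r0 : 0 < r := rad_gt0 v0.
have NG := near_good (rad_gt v0) (rad_good v0).
pose F v z := f (upd v i z) * ckernel (co v i) z.
apply: (@near_eq_diff _ _ _ (fun v => mean r (F v))).
  apply: filterS NG => v [g1 g2];
    rewrite -[LHS]/(cauchy_mean r (fun z => f (upd v i z)) (co v i)) /ext.
  case: (leP r (rad S i v)) => [rr|/ltW rr].
    exact: cauchy_indep.
  by apply/esym/cauchy_indep => //; [exact: rad_gt|exact: rad_good].
apply: (@differentiable_mean R V F v0 r (ltW r0)).
- move=> z zr; have zy : z - co v0 i != 0.
    by rewrite subr_eq0; apply: contraTneq (rad_gt v0) => <-; rewrite zr ltxx.
  apply: (@continuousM C _ (fun p : V * C => f (upd p.1 i p.2)) (fun p => ckernel (co p.1 i)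
    p.2)).
    by apply: continuous_f_upd; apply: upd_Om; rewrite zr; exact: rad_good.
  apply: (@continuousM C _ (fun p : V * C => p.2) (fun p => (p.2 - co p.1 i)^-1)).
    exact: cvg_snd.
  apply: (@continuousV C _ (fun p : V * C => p.2 - co p.1 i)) => //.
  apply: (@continuousB C _ _ (fun p : V * C => p.2) (fun p => co p.1 i)).
    exact: cvg_snd.
  apply: (@continuous_comp _ _ _ fst (fun w : V => co w i)); first exact: cvg_fst.
  exact: continuous_co.
apply: filterS NG => v [g1 g2] z zr.
have zv : z != co v i by apply: contraTneq g1 => <-; rewrite zr ltxx.
have Ov : Om (upd v i z) by apply: upd_Om; rewrite zr.
split.
  apply: (@differentiableM _ _ (fun v => f (upd v i z)) (fun v => ckernel (co v i) z)).
    apply: (@differentiable_comp _ _ _ _ (fun v => upd v i z) f); last exact: fd.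
    exact: differentiable_upd_v.
  apply: (@differentiableM _ _ (fun=> z) (fun v => (z - co v i)^-1)).
    exact: differentiable_cst.
  apply: (@differentiableV _ _ (fun v : V => z - co v i)); last by rewrite subr_eq0.
  apply: (@differentiableB _ _ _ (fun=> z) (fun v : V => co v i)).
    exact: differentiable_cst.
  exact: differentiable_co.
apply/differentiable_continuous.
apply: (@differentiableM _ _ (fun z => f (upd v i z)) (ckernel (co v i))).
  by apply: diff_f_upd; rewrite zr.
exact: differentiable_ckernel.
Qed.

Lemma Hr_upd v z : Hr i (upd v j z) = Hr i v - rn (co v j) ^+ 2 + rn z ^+ 2.
Proof. by rewrite /Hr Hf_upd // co_upd (negbTE ij); ring. Qed.

Lemma differentiable_pow k z : differentiable (fun z : C => z ^+ k) z.
Proof.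
elim: k => [|k IH]; first exact: differentiable_cst.
rewrite (_ : (fun z : C => z ^+ k.+1) = (fun z => z * z ^+ k)); last first.
  by apply/funext => w; rewrite exprS.
by apply: (@differentiableM _ _ (id : C -> C) (fun z => z ^+ k)).
Qed.

(* This Laurent coefficient in the [i]-th variable is an entire function of the [j]-th
   one, and it vanishes where [|v_j|] is large, as there the [z]-disc lies in [Om]. *)
Lemma coef_eq0 v r k : 0 < r -> 0 < Hr i v + r ^+ 2 ->
  mean r (fun z => f (upd v i z) * z ^+ k.+1) = 0.
Proof.
move=> r0 H.
(* Large enough that the circle stays in the cone whatever the [j]-th coordinate becomes, 0
   included. *)
pose r1 := r + 1 + rn (co v j) ^+ 2.
have vj0 := sqr_ge0 (rn (co v j)).
have r1r : r <= r1 by rewrite /r1; lra.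
have r10 : 0 < r1 by lra.
have G w z : 0 < Hr i w + rn z ^+ 2 -> differentiable (fun z => f (upd w i z) * z ^+ k.+1) z.
  move=> wz; apply: (@differentiableM _ _ (fun z => f (upd w i z)) (fun z : C => z ^+ k.+1)).
    exact: diff_f_upd.
  exact: differentiable_pow.
rewrite (@mean_annulus _ r r1 _ r0 r1r); last first.
  by move=> z /andP[rz _]; apply: G; exact: good_mono (ltW r0) rz H.
have good x z : rn z = r1 -> 0 < Hr i (upd v j x) + rn z ^+ 2.
  move=> ->; rewrite Hr_upd; have := sqr_ge0 (rn x); rewrite /r1; nra.
pose F (x z : C) := f (upd (upd v j x) i z) * z ^+ k.+1.
pose b x := mean r1 (F x).
have bd x : differentiable b x.
  apply: (@differentiable_mean R C F x r1 (ltW r10)).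
  - move=> z zr.
    apply: (@continuousM C _ (fun p : C * C => f (upd (upd v j p.1) i p.2)) (fun p => p.2 ^+
      k.+1)).
      apply: (@continuous_comp _ _ _ (fun p : C * C => (upd v j p.1, p.2)) (fun p : V * C => f
        (upd p.1 i p.2))).
        have c1 : upd v j p.1 @[p --> (x, z)] --> upd v j x.
          have c0 : p.1 @[p --> (x, z)] --> x by exact: cvg_fst.
          have cu : upd v j @ x --> upd v j x.
            by apply: differentiable_continuous; exact: differentiable_upd_z.
          exact: (cvg_comp _ _ c0 cu).
        exact: (@cvg_pair _ _ _ _ (nbhs (upd v j x)) (nbhs z) _ _ _ (fun p : C * C => upd v j
          p.1) snd c1 cvg_snd).
      apply: continuous_f_upd; apply: upd_Om; exact: good.
    apply: (@continuous_comp _ _ _ snd (fun z : C => z ^+ k.+1)); first exact: cvg_snd.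
    exact/differentiable_continuous/differentiable_pow.
  apply: (@nearW _ (nbhs x) _ (nbhs_filter x)) => y z zr; split.
    apply: (@differentiableM _ _ (fun x => f (upd (upd v j x) i z)) (fun=> z ^+ k.+1)).
      apply: (@differentiable_comp _ _ _ _ (upd v j) (fun w => f (upd w i z))).
        exact: differentiable_upd_z.
      apply: (@differentiable_comp _ _ _ _ (fun w => upd w i z) f).
        exact: differentiable_upd_v.
      apply: fd; apply: upd_Om; exact: good.
    exact: differentiable_cst.
  by apply: differentiable_continuous; apply: G; exact: good.
(* The whole [z]-disc now lies in the cone, and the factor [z ^+ k.+1] vanishes at its centre. *)
have b0 x : 0 < Hr i (upd v j x) -> b x = 0.
  move=> Hx; rewrite /b /F.
  rewrite (@mean_disc _ r1 (-1) _ r10); first by rewrite expr0n mulr0.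
    by move=> z _; apply: differentiable_continuous; apply: G; rewrite ltr_wpDr // sqr_ge0.
  by move=> z _ _; apply: G; rewrite ltr_wpDr // sqr_ge0.
rewrite -[LHS]/(mean r1 (fun z => f (upd v i z) * z ^+ k.+1)) -{1}(upd_id v j).
rewrite -[LHS]/(b (co v j)).
(* On the circle of radius [q] the entire function [b] vanishes, and Cauchy's formula carries this
   to the interior point [co v j]. *)
pose q := rn (co v j) + `|Hr i v - rn (co v j) ^+ 2| + 1.
have qj : rn (co v j) < q by rewrite /q; have := normr_ge0 (Hr i v - rn (co v j) ^+ 2); lra.
have q0 : 0 <= q := ltW (le_lt_trans (rn_ge0 _) qj).
rewrite -(cauchy_disc qj (fun x _ => bd x)) /cauchy_mean.
rewrite -[RHS](mean_cst q); apply: (eq_mean q0) => x xq.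
rewrite b0 ?mul0r // Hr_upd xq /q.
have h1 := normr_ge0 (Hr i v - rn (co v j) ^+ 2); have h2 := rn_ge0 (co v j).
have h3 := ler_norm (- (Hr i v - rn (co v j) ^+ 2)); rewrite normrN in h3.
by set A := `|_| in h1 h3 *; nra.
Qed.

(** A finite geometric expansion: [ckernel y z = y^-1 * (ckernel y z * z) - y^-1 * z], and at each
    stage the last term contributes 0 by [coef_eq0]. After [N] stages a multiple of
    [(r / rn y) ^+ N] bounds the mean. *)
Lemma cauchy_inner0 v r : 0 < r -> 0 < Hr i v + r ^+ 2 -> r < rn (co v i) ->
  cauchy_mean r (fun z => f (upd v i z)) (co v i) = 0.
Proof.
move=> r0 H; set y := co v i => ry.
have y0 : y != 0 by rewrite -rn_gt0; exact: lt_trans ry.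
have yr : rn y != r by rewrite gt_eqF.
have cf : cts_at_circle r (fun z => f (upd v i z)).
  by move=> z zr; apply: differentiable_continuous; apply: diff_f_upd; rewrite zr.
have ck := cts_at_ckernel yr.
have cp k : cts_at_circle r (fun z => z ^+ k).
  by move=> z zr; apply: differentiable_continuous; exact: differentiable_pow.
have cc (c : C) : cts_at_circle r (fun=> c) by move=> z _; exact: cst_continuous.
have step N : cauchy_mean r (fun z => f (upd v i z)) y =
    (y^-1) ^+ N * mean r (fun z => f (upd v i z) * ckernel y z * z ^+ N).
  elim: N => [|N ->].
    by rewrite expr0 mul1r; apply: (eq_mean (ltW r0)) => z _; rewrite mulr1.
  rewrite exprSr -mulrA; congr (_ * _).
  have cA := cts_at_circleM (cts_at_circleM cf ck) (cp N.+1).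
  have cB := cts_at_circleM cf (cp N.+1).
  rewrite -[RHS]subr0 -(mulr0 y^-1) -(coef_eq0 N r0 H).
  rewrite -(meanZ y^-1 (ltW r0) cA) -(meanZ y^-1 (ltW r0) cB).
  rewrite -(meanB (ltW r0) (cts_at_circleM (cc y^-1) cA) (cts_at_circleM (cc y^-1) cB)).
  apply: (eq_mean (ltW r0)) => z zr; have zy : z - y != 0.
    by rewrite subr_eq0; apply: contraTneq ry => <-; rewrite zr ltxx.
  by rewrite /ckernel exprS; field; rewrite y0 zy.
have p20 := ltW (pi2_gt0 R).
have [M HM] := bounded_on_itv p20 (cts_circle (ltW r0) (cts_at_circleM cf ck)).
apply: eq_eps => e e0.
have q1 : `|r / rn y| < 1.
  rewrite ger0_norm ?divr_ge0 ?rn_ge0 ?(ltW r0) //.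
  by rewrite ltr_pdivrMr ?mul1r // (lt_trans r0).
have M0 : 0 <= M.
  by apply: le_trans (HM 0 _); rewrite ?rn_ge0 ?lexx.
have e1 : 0 < e / (2 * M + 1) by rewrite divr_gt0 // ltr_wpDl // mulr_ge0.
have /cvgr0_norm_lt/(_ _ e1) [N _ HN] := cvg_expr q1.
rewrite (step N) rnM rnX rnV.
apply: (@le_trans _ _ ((rn y)^-1 ^+ N * (2 * (M * r ^+ N)))).
  rewrite ler_wpM2l ?exprn_ge0 ?invr_ge0 ?rn_ge0 //.
  apply: (avg_bound (cts_circle (ltW r0) (cts_at_circleM (cts_at_circleM cf ck) (cp N)))).
  move=> t ht; rewrite rnM rnX rn_circle ?(ltW r0) // ler_wpM2r ?exprn_ge0 ?(ltW r0) //.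
  exact: HM.
have -> : (rn y)^-1 ^+ N * (2 * (M * r ^+ N)) = 2 * M * (r / rn y) ^+ N.
  by rewrite exprMn; ring.
have := HN N (leqnn N); rewrite /= ltr_pdivlMr; last by rewrite ltr_wpDl // mulr_ge0.
have := ler_norm ((r / rn y) ^+ N).
set a := _ ^+ N; have := normr_ge0 a; set A := `|a|; move=> *; nra.
Qed.

(** If [Hr S i v] is positive, the full disc lies in the cone and Cauchy's formula applies.
    Otherwise only an annulus does, and its inner Laurent part is 0. *)
Lemma ext_eq v : Om v -> ext S i f v = f v.
Proof.
move=> Ov; rewrite /ext; set y := co v i; set g := fun z => _.
have gy : g y = f v by rewrite /g upd_id.
have [H0|H0] := ltP 0 (Hr i v).
  have D z : rn z <= rad S i v -> differentiable g z.
    by move=> _; apply: diff_f_upd; rewrite ltr_wpDr // sqr_ge0.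
  by rewrite (cauchy_disc (rad_gt v) D).
have Ov' : - Hr i v < rn y ^+ 2 by move: Ov; rewrite /Om /Hr /= -/y; lra.
(* [r ^+ 2] is the midpoint of [- Hr S i v] and [rn y ^+ 2]: a circle still in the cone, yet inside
   the one through [y]. *)
pose r := Num.sqrt ((rn y ^+ 2 - Hr i v) / 2).
have q0 : 0 < (rn y ^+ 2 - Hr i v) / 2 by have := sqr_ge0 (rn y); lra.
have r2 : r ^+ 2 = (rn y ^+ 2 - Hr i v) / 2 by rewrite sqr_sqrtr // ltW.
have r0 : 0 < r by rewrite sqrtr_gt0.
have rH : 0 < Hr i v + r ^+ 2 by rewrite r2; lra.
have ry : r < rn y.
  by rewrite -ltr_sqr ?nnegrE ?rn_ge0 ?(ltW r0) // r2; lra.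
rewrite -gy -(@laurent _ r (rad S i v) g y r0 ry (rad_gt v)).
  by rewrite (cauchy_inner0 r0 rH ry) subr0.
by move=> z /andP[rz _]; apply: diff_f_upd; exact: good_mono (ltW r0) rz rH.
Qed.

End Fun.

(** Both values are Cauchy integrals over a circle in the [i]-th variable that lies in the cone,
    where the integrands agree. *)
Lemma entire_eq (f g : V -> C) : (forall v, differentiable f v) ->
  (forall v, differentiable g v) -> (forall v, Om v -> f v = g v) -> f =1 g.
Proof.
move=> df dg E v; rewrite -(upd_id v i).
have D (h : V -> C) : (forall v, differentiable h v) -> forall z : C,
    rn z <= rad S i v -> differentiable (fun z => h (upd v i z)) z.
  move=> dh z _; apply: (@differentiable_comp _ _ _ _ (upd v i) h); last exact: dh.
  exact: differentiable_upd_z.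
rewrite -(cauchy_disc (rad_gt v) (D f df)) -(cauchy_disc (rad_gt v) (D g dg)).
apply: eq_mean => [|z zr]; first exact/ltW/rad_gt0.
by rewrite E //; apply: upd_Om; rewrite zr; exact: rad_good.
Qed.

Lemma hartogs (f : V -> V) : (forall v, Om v -> differentiable f v) ->
  exists2 F : V -> V, (forall v, differentiable F v) & forall v, Om v -> F v = f v.
Proof.
move=> fd; exists (fun v => \row_k ext S i (fun w => co (f w) k) v) => v.
  apply: differentiable_row => k.
  rewrite (_ : (fun w => _) = ext S i (fun w => co (f w) k)); last first.
    by apply/funext => w; rewrite /co mxE.
  apply: ext_diff => w Ow.
  apply: (@differentiable_comp _ _ _ _ f (fun w => co w k)); first exact: fd.
  exact: differentiable_co.
move=> Ov; apply: coP => k; rewrite [LHS]/co mxE.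
rewrite ext_eq // => w Ow.
apply: (@differentiable_comp _ _ _ _ f (fun w => co w k)); first exact: fd.
exact: differentiable_co.
Qed.

Lemma entire_eqV (f g : V -> V) : (forall v, differentiable f v) ->
  (forall v, differentiable g v) -> (forall v, Om v -> f v = g v) -> f =1 g.
Proof.
move=> df dg E v; apply: coP => k.
apply: (@entire_eq (fun w => co (f w) k) (fun w => co (g w) k)) => [w|w|w /E -> //].
  by apply: (@differentiable_comp _ _ _ _ f (fun w => co w k)); [by []|exact: differentiable_co].
by apply: (@differentiable_comp _ _ _ _ g (fun w => co w k)); [by []|exact: differentiable_co].
Qed.

End Hartogs.

(** * The Hermitian form and transitivity *)

Definition cj (R : realType) (z : CC R) : CC R := conjc z.
Definition hp (R : realType) n (S : {set 'I_n}) (v w : Cn R n) : CC R :=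
  \sum_k rc (sg R S k) * co v k * cj (co w k).

Section Form.
Variables (R : realType) (n : nat) (S : {set 'I_n}).
Local Notation C := (CC R).
Local Notation V := (Cn R n).
Implicit Types (v w x d : V) (i j k : 'I_n) (a z : C).

Lemma cjD a z : cj (a + z) = cj a + cj z.
Proof. exact: (rmorphD (@conjc R)). Qed.
Lemma cjM a z : cj (a * z) = cj a * cj z.
Proof. exact: (rmorphM (@conjc R)). Qed.
Lemma cjN z : cj (- z) = - cj z.
Proof. exact: (rmorphN (@conjc R)). Qed.
Lemma cj1 : cj (1 : C) = 1.
Proof. exact: (rmorph1 (@conjc R)). Qed.
Lemma cjK z : cj (cj z) = z.
Proof. exact: conjcK. Qed.
Lemma cjV z : cj z^-1 = (cj z)^-1.
Proof. exact: (fmorphV (@conjc R)). Qed.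
Lemma cj_eq0 z : (cj z == 0) = (z == 0).
Proof. exact: (fmorph_eq0 (@conjc R)). Qed.
Lemma cj_rc (r : R) : cj (rc r) = rc r.
Proof. exact: conjc_real. Qed.
Lemma mul_cj z : z * cj z = rc (rn z ^+ 2).
Proof. by rewrite rn_sqr; case: z => p q; apply: Cext; rewrite /cRe /cIm /=; ring. Qed.

Lemma hp_Hf v : hp S v v = rc (Hf S v).
Proof.
rewrite /hp /Hf (big_morph (@rc R) (@rcD R) (erefl _)).
by apply: eq_bigr => k _; rewrite -mulrA mul_cj rcM.
Qed.

Lemma hpDl v w x : hp S (v + w) x = hp S v x + hp S w x.
Proof. by rewrite -big_split /=; apply: eq_bigr => k _; rewrite coD; ring. Qed.
Lemma hpZl a v x : hp S (a *: v) x = a * hp S v x.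
Proof. by rewrite /hp big_distrr /=; apply: eq_bigr => k _; rewrite coZ; ring. Qed.
Lemma cj_hp v w : cj (hp S v w) = hp S w v.
Proof.
rewrite /hp (big_morph (@cj R) cjD (_ : cj 0 = 0)); last exact: (rmorph0 (@conjc R)).
by apply: eq_bigr => k _; rewrite !cjM cjK cj_rc; ring.
Qed.
Lemma hpNl v x : hp S (- v) x = - hp S v x.
Proof. by rewrite -scaleN1r hpZl mulN1r. Qed.
Lemma hpDr v w x : hp S x (v + w) = hp S x v + hp S x w.
Proof. by rewrite -cj_hp hpDl cjD !cj_hp. Qed.
Lemma hpZr a v x : hp S x (a *: v) = cj a * hp S x v.
Proof. by rewrite -cj_hp hpZl cjM !cj_hp. Qed.
Lemma hpNr v x : hp S x (- v) = - hp S x v.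
Proof. by rewrite -cj_hp hpNl cjN cj_hp. Qed.

Lemma HfZ a v : Hf S (a *: v) = rn a ^+ 2 * Hf S v.
Proof.
by apply: rc_inj; rewrite -hp_Hf hpZl hpZr mulrA mul_cj hp_Hf rcM.
Qed.

Lemma HfD v x : Hf S (v + x) = Hf S v + 2 * cRe (hp S x v) + Hf S x.
Proof.
apply: rc_inj; rewrite -hp_Hf hpDl !hpDr !rcD -!hp_Hf rcM.
have -> : rc 2 * rc (cRe (hp S x v)) = hp S x v + cj (hp S x v) :> C.
  rewrite {2 3}(ptE (hp S x v)); apply: Cext; rewrite /rc /cj /pt /cRe /cIm /=; ring.
by rewrite cj_hp; ring.
Qed.

Lemma differentiable_hp d v : differentiable (fun x => hp S x d) v.
Proof.
rewrite (_ : (fun x => _) = \sum_k (fun x => rc (sg R S k) * cj (co d k) * co x k)); last first.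
  by apply/funext => x; rewrite fct_sumE; apply: eq_bigr => k _; ring.
apply: differentiable_sum => k.
apply: (@differentiableM _ _ (fun=> _) (fun x => co x k)); first exact: differentiable_cst.
exact: differentiable_co.
Qed.

(* A complex reflection: it sends [v] to [v - d] when [c = hp v d]. *)
Definition refl d (c : C) x : V := x - (hp S x d / c) *: d.

Lemma differentiable_refl d c v : differentiable (refl d c) v.
Proof.
apply: (@differentiableB _ _ _ id (fun x => (hp S x d / c) *: d)); first by [].
apply: (@differentiableZl _ _ _ (fun x => hp S x d / c) d).
apply: (@differentiableM _ _ (fun x => hp S x d) (fun=> c^-1)).
  exact: differentiable_hp.
exact: differentiable_cst.
Qed.

Lemma reflK d c c' x : c != 0 -> c' != 0 -> hp S d d = c + c' ->
  refl d c' (refl d c x) = x.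
Proof.
move=> c0 c'0 E; rewrite /refl hpDl hpNl hpZl E -addrA -opprD -scalerDl.
have -> : hp S x d / c + (hp S x d - hp S x d / c * (c + c')) / c' = 0.
  by field; rewrite c0 c'0.
by rewrite scale0r subr0.
Qed.

(** The extra terms of the expansion cancel since [1 / c + 1 / cj c = hp S d d / (c * cj c)]. *)
Lemma Hf_refl d c x : c != 0 -> hp S d d = c + cj c -> Hf S (refl d c x) = Hf S x.
Proof.
move=> c0 E; have c0' : cj c != 0 by rewrite cj_eq0.
apply: rc_inj; rewrite -!hp_Hf /refl !(hpDl, hpDr, hpNl, hpNr, hpZl, hpZr) E.
by rewrite cjM cjV cj_hp; field; rewrite c0 c0'.
Qed.

End Form.

(** * Automorphisms of the cone *)

Section Aut.
Variables (R : realType) (n : nat).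
Local Notation C := (CC R).
Local Notation V := (Cn R n).
Implicit Types (f g : V -> V) (D : set V).

Lemma is_aut_comp D f g : is_aut D f -> is_aut D g -> is_aut D (f \o g).
Proof.
move=> [f' [F1 F2 F3 F4 [F5 F6]]] [g' [G1 G2 G3 G4 [G5 G6]]].
have gD z : D z -> D (g z) by move=> Dz; apply: G3; exists z.
have fD z : D z -> D (f' z) by move=> Dz; apply: F4; exists z.
exists (g' \o f'); split.
- move=> z Dz; apply: differentiable_comp; first exact: G1.
  exact/F1/gD.
- move=> z Dz; apply: differentiable_comp; first exact: F2.
  exact/G2/fD.
- by move=> _ [z Dz <-] /=; apply: F3; exists (g z) => //; exact: gD.
- by move=> _ [z Dz <-] /=; apply: G4; exists (f' z) => //; exact: fD.
- split=> z Dz /=; first by rewrite F5 ?G5 //; exact: gD.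
  by rewrite G6 ?F6 //; exact: fD.
Qed.

Lemma entire_aut D f g : (forall v, differentiable f v) ->
  (forall v, differentiable g v) -> cancel f g -> cancel g f ->
  (forall v, D v -> D (f v)) -> (forall v, D v -> D (g v)) -> is_aut D f.
Proof.
move=> df dg fg gf fD gD; exists g; split.
- by move=> z _; exact: df.
- by move=> z _; exact: dg.
- by move=> _ [z Dz <-]; exact: fD.
- by move=> _ [z Dz <-]; exact: gD.
- by split=> z _; [exact: fg|exact: gf].
Qed.

Variable S : {set 'I_n}.

Lemma differentiable_scale (a : C) (v : V) : differentiable (fun x : V => a *: x) v.
Proof. exact: (@differentiableZ _ _ _ (id : V -> V) a). Qed.

Lemma scale_aut (a : C) : a != 0 -> is_aut (Om S) (fun x : V => a *: x).
Proof.
move=> a0.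
have pos (b : C) (v : V) : b != 0 -> Om S v -> Om S (b *: v).
  by move=> b0; rewrite /Om /= HfZ => Hv; rewrite mulr_gt0 // exprn_gt0 // rn_gt0.
apply: (@entire_aut _ _ (fun x : V => a^-1 *: x)).
- by move=> v; exact: differentiable_scale.
- by move=> v; exact: differentiable_scale.
- by move=> v; rewrite scalerA mulVf // scale1r.
- by move=> v; rewrite scalerA mulfV // scale1r.
- by move=> v; exact: pos.
- by move=> v; apply: pos; rewrite invr_eq0.
Qed.

Lemma refl_aut (d : V) (c : C) : c != 0 -> hp S d d = c + cj c ->
  is_aut (Om S) (refl S d c).
Proof.
move=> c0 E; have c0' : cj c != 0 by rewrite cj_eq0.
have E' : hp S d d = cj c + cj (cj c) by rewrite cjK E addrC.
apply: (@entire_aut _ _ (refl S d (cj c))).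
- by move=> v; exact: differentiable_refl.
- by move=> v; exact: differentiable_refl.
- by move=> x; exact: reflK.
- by move=> x; apply: reflK => //; rewrite E addrC.
- by move=> v; rewrite /Om /= Hf_refl.
- by move=> v; rewrite /Om /= Hf_refl.
Qed.

(** The reflection along [d = v - w] with [c = hp S v d] does it, even for isotropic [d], as long as
    [c = 1 - hp S v w] is nonzero. In the remaining case [w] is replaced by [- w], followed by the
    scalar -1. *)
Lemma unit_transitive (v w : V) : Hf S v = 1 -> Hf S w = 1 ->
  exists f, is_aut (Om S) f /\ f v = w.
Proof.
have main (v' w' : V) : Hf S v' = 1 -> Hf S w' = 1 -> hp S v' w' != 1 ->
    exists f, is_aut (Om S) f /\ f v' = w'.
  move=> Hv Hw ne; pose d := v' - w'; pose c := hp S v' d.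
  have cE : c = 1 - hp S v' w' by rewrite /c /d hpDr hpNr hp_Hf Hv.
  have c0 : c != 0 by rewrite cE subr_eq0 eq_sym.
  exists (refl S d c); split.
    apply: refl_aut => //; rewrite cE cjD cjN cj_hp cj1.
    rewrite /d !(hpDl, hpDr, hpNl, hpNr) !hp_Hf Hv Hw rc1; ring.
  by rewrite /refl -/c mulfV // scale1r /d opprB addrC subrK.
move=> Hv Hw; have [E|ne] := eqVneq (hp S v w) 1; last exact: main.
have Hw' : Hf S (- w) = 1 by rewrite -scaleN1r HfZ rnN rn1 expr1n mul1r.
have [|f [fA fv]] := main v (- w) Hv Hw'.
  by rewrite hpNr E; apply/eqP => /(congr1 (@cRe R)); rewrite /cRe /=; lra.
exists ((fun x : V => (-1 : C) *: x) \o f); split.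
  by apply: is_aut_comp => //; apply: scale_aut; rewrite oppr_eq0 oner_eq0.
by rewrite /= fv scaleN1r opprK.
Qed.

Lemma homogeneous_Om : homogeneous (@Om R n S).
Proof.
move=> v w Dv Dw.
have nrm (u : V) : Om S u -> exists2 a : C, a != 0 & Hf S (a *: u) = 1.
  rewrite /Om /= => Du; exists (rc (Num.sqrt (Hf S u))^-1).
    by rewrite rc_eq0 invr_eq0 gt_eqF // sqrtr_gt0.
  rewrite HfZ rn_rc ger0_norm ?invr_ge0 ?sqrtr_ge0 // exprVn sqr_sqrtr ?(ltW Du) //.
  by rewrite mulVf // gt_eqF.
have [a a0 Ha] := nrm v Dv; have [b b0 Hb] := nrm w Dw.
have [f [fA fE]] := unit_transitive Ha Hb.
exists ((fun x : V => b^-1 *: x) \o (f \o (fun x : V => a *: x))); split.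
  apply: is_aut_comp; first by apply: scale_aut; rewrite invr_eq0.
  by apply: is_aut_comp => //; exact: scale_aut.
by rewrite /= fE scalerA mulVf // scale1r.
Qed.

End Aut.

(** * Connectedness *)

Section Topology.
Variables (R : realType) (n : nat) (S : {set 'I_n}).
Local Notation C := (CC R).
Local Notation V := (Cn R n).
Local Notation Om := (@Om R n S).
Implicit Types (u v w x : V) (i j k : 'I_n).

Lemma Hf_split v : Hf S v = \sum_(k in S) rn (co v k) ^+ 2 -
  \sum_(k in ~: S) rn (co v k) ^+ 2.
Proof.
rewrite /Hf (bigID (mem S)) /= -sumrN; congr (_ + _).
  by apply: eq_bigr => k kS; rewrite sg_in // mul1r.
apply: eq_big => [k|k kS]; first by rewrite inE.
by rewrite /sg (negbTE kS) mulN1r.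
Qed.

Lemma Hf_setC v : Hf (~: S) v = - Hf S v.
Proof.
rewrite /Hf -sumrN; apply: eq_bigr => k _; rewrite /sg inE.
by case: (k \in S); rewrite /= ?mul1r ?mulN1r ?opprK.
Qed.

Lemma Hf_ev i (a : C) : i \in S -> Hf S (a *: ev R i) = rn a ^+ 2.
Proof.
move=> iS; rewrite HfZ /Hf (bigD1 i) //= big1 => [|k ki].
  by rewrite co_ev eqxx rn1 sg_in // expr1n addr0 !mulr1.
by rewrite co_ev (negbTE ki) rn0 expr0n mulr0.
Qed.

Lemma Om_ev i (a : C) : i \in S -> a != 0 -> Om (a *: ev R i).
Proof. by move=> iS a0; rewrite /Om /= Hf_ev // exprn_gt0 // rn_gt0. Qed.

(** Connected subsets instead of paths, so that concatenation is a union. *)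
Definition linked v w := exists A : set V, [/\ connected A, A `<=` Om, A v & A w].

Lemma linked_trans w v u : linked v w -> linked w u -> linked v u.
Proof.
move=> [A [cA sA Av Aw]] [B [cB sB Bw Bu]]; exists (A `|` B); split.
- by apply: connectedU => //; exists w.
- by rewrite subUset; split.
- by left.
- by right.
Qed.

Lemma linked_seg v w :
  (forall t : R, 0 <= t <= 1 -> Om (v + rc t *: (w - v))) -> linked v w.
Proof.
move=> H; exists ((fun t : R => v + rc t *: (w - v)) @` `[0, 1]%classic); split.
- apply: connected_continuous_connected; first exact: segment_connected.
  apply: continuous_subspaceT => t; apply: cvgD; first exact: cvg_cst.
  by apply: cvgZr_tmp; exact: continuous_rc.
- by move=> _ [t + <-]; rewrite /= in_itv; exact: H.
- by exists 0; rewrite ?rc0 ?scale0r ?addr0 //= in_itv /= lexx ler01.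
- by exists 1; rewrite ?rc1 ?scale1r ?(addrC v) ?subrK //= in_itv /= lexx ler01.
Qed.

Definition proj v : V := \row_k (if k \in S then co v k else 0).

Lemma co_seg v w (t : R) k :
  co (v + rc t *: (w - v)) k = rc (1 - t) * co v k + rc t * co w k.
Proof. by rewrite coD coZ coD coN rcB rc1; ring. Qed.

(** Along the segment the [S]-coordinates stay fixed and the others are multiplied by [1 - t], so
    the form never decreases. *)
Lemma linked_proj v : Om v -> linked v (proj v).
Proof.
move=> Ov; apply: linked_seg => t /andP[t0 t1].
rewrite /Om /= Hf_split; rewrite /Om /= Hf_split in Ov.
apply: lt_le_trans Ov _; apply: lerB.
  apply: ler_sum => k kS; rewrite co_seg /proj {3}/co mxE kS.
  by rewrite -mulrDl -rcD subrK rc1 mul1r.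
apply: ler_sum => k; rewrite inE => kS; rewrite co_seg /proj {2}/co mxE (negbTE kS).
rewrite mulr0 addr0 rnM rn_rc exprMn ler_piMl ?sqr_ge0 //.
by rewrite exprn_ile1 // ger0_norm; lra.
Qed.

Lemma Om_supp v k : (forall k, k \notin S -> co v k = 0) -> co v k != 0 -> Om v.
Proof.
move=> v0 vk; rewrite /Om /= Hf_split [X in _ - X]big1; last first.
  by move=> l; rewrite inE => /v0 ->; rewrite rn0 expr0n.
have kS : k \in S by apply: contraNT vk => /v0 ->.
rewrite subr0 (bigD1 k) //= ltr_wpDr ?exprn_gt0 ?rn_gt0 //.
by apply: sumr_ge0 => l _; rewrite sqr_ge0.
Qed.

(** For [t < 1] the [k]-th coordinate keeps the segment away from 0, as [ev R i] does not affect it;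
    with [k = i] the segment could run through 0. *)
Lemma linked_ev v i k : i \in S -> (forall k, k \notin S -> co v k = 0) ->
  k != i -> co v k != 0 -> linked v (ev R i).
Proof.
move=> iS v0 ki vk; apply: linked_seg => t /andP[t0 t1].
have supp l : l \notin S -> co (v + rc t *: (ev R i - v)) l = 0.
  move=> lS; rewrite co_seg v0 // co_ev; case: eqP lS => [->|_ _]; first by rewrite iS.
  by rewrite !mulr0 addr0.
have [t_1|t_1] := eqVneq t 1.
  apply: (@Om_supp _ i supp).
  by rewrite co_seg t_1 subrr rc0 rc1 co_ev eqxx mul0r add0r mulr1 oner_eq0.
apply: (@Om_supp _ k supp); rewrite co_seg co_ev (negbTE ki) mulr0 addr0.
by rewrite mulf_neq0 // rc_eq0 subr_eq0 eq_sym.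
Qed.

Lemma connected_Om i j : i \in S -> j \in S -> i != j -> connected Om.
Proof.
move=> iS jS ij.
have evs l : l \in S -> forall k, k \notin S -> co (ev R l) k = 0.
  by move=> lS k kS; rewrite co_ev; case: eqP kS => // ->; rewrite lS.
have L v : Om v -> linked v (ev R i).
  move=> Ov; apply: (linked_trans (linked_proj Ov)).
  have ps k : k \notin S -> co (proj v) k = 0.
    by move=> kS; rewrite /co mxE (negbTE kS).
  have [k kS vk] : exists2 k, k \in S & co v k != 0.
    apply: contrapT => H; move: Ov; apply/negP; rewrite -leNgt Hf_split.
    rewrite big1 => [|k kS].
      by rewrite sub0r oppr_le0; apply: sumr_ge0 => k _; exact: sqr_ge0.
    have -> : co v k = 0 by apply/eqP/negPn/negP => vk; apply: H; exists k.
    by rewrite rn0 expr0n.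
  have pk : co (proj v) k != 0 by rewrite /co mxE kS.
  have [ki|ki] := eqVneq k i; last exact: linked_ev ps ki pk.
  (* Only the [i]-th coordinate is known to be nonzero, so the direct segment might meet 0; the
     detour through [ev R j] avoids it. *)
  apply: (@linked_trans (ev R j)).
    by apply: linked_ev ps _ pk; rewrite // ki.
  apply: (linked_ev iS (evs j jS) (k := j)); first by rewrite eq_sym.
  by rewrite co_ev eqxx oner_neq0.
have /choice[A HA] : forall v, exists A : set V, Om v -> [/\ connected A, A `<=` Om, A v & A
  (ev R i)].
  by move=> v; have [/L[A ?]|?] := pselect (Om v); [exists A|exists set0].
have -> : Om = \bigcup_(v in Om) A v.
  apply/seteqP; split=> [v Ov|v [w Ow]]; first by exists v => //; case: (HA v Ov).
  by case: (HA w Ow) => _ + _ _; exact.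
apply: bigcup_connected => [|v Ov]; last by case: (HA v Ov).
by exists (ev R i) => v Ov; case: (HA v Ov).
Qed.

Lemma domain_Om i j : i \in S -> j \in S -> i != j -> is_domain Om.
Proof.
move=> iS jS ij; split; last by split; [exact: open_Om|exact: connected_Om ij].
exists (1 *: ev R i); apply: Om_ev => //; exact: oner_neq0.
Qed.

Lemma unbounded_Om i : i \in S -> ~ bounded_set Om.
Proof.
move=> iS /pinfty_ex_gt0[_ /gt0_rc[M M0 ->]] /= H.
have e0 : 0 < rn (ev R i).
  rewrite rn_gt0; apply/eqP => /(congr1 (fun v => co v i)).
  by rewrite co_ev eqxx co0 => /eqP; rewrite oner_eq0.
pose t := (M + 1) / rn (ev R i).
have t0 : 0 < t by rewrite divr_gt0 // ltr_wpDl // ltW.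
have Ot : Om (rc t *: ev R i) by apply: Om_ev => //; rewrite rc_eq0 gt_eqF.
have := H _ Ot; rewrite normE rc_le rnZ rn_rc gtr0_norm // divfK ?gt_eqF //; lra.
Qed.

End Topology.

(** * Automorphism groups and non-equivalence *)

Definition has_pair n (S : {set 'I_n}) := exists i j, [/\ i \in S, j \in S & i != j].

Section Iso.
Variables (R : realType) (n : nat).
Local Notation C := (CC R).
Local Notation V := (Cn R n).
Local Notation Om := (@Om R n).
Implicit Types (u v w x : V) (i j k : 'I_n) (S T : {set 'I_n}) (f g F G : V -> V).
Local Notation entire F := (forall v : V, differentiable F v).

Lemma OmE S v : Om S v = (0 < Hf S v) :> Prop.
Proof. by []. Qed.

(** The extensions are mutually inverse on the cones, hence everywhere by [entire_eqV]. *)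
Lemma biholo_entire S T f g : has_pair S -> has_pair T ->
  biholo_pair (Om S) (Om T) f g ->
  exists F G, [/\ entire F, entire G, cancel F G, cancel G F
    & (forall v, Om S v -> F v = f v) /\ (forall v, Om T v -> G v = g v)].
Proof.
move=> [i [j [iS jS ij]]] [k [l [kT lT kl]]] [hf hg fST gTS [gf fg]].
have [F dF EF] := hartogs iS jS ij hf.
have [G dG EG] := hartogs kT lT kl hg.
have did : entire (id : V -> V) by [].
exists F, G; split=> //.
- suff H : G \o F =1 id by move=> v; exact: H.
  apply: (entire_eqV iS (f := G \o F) (g := id)) => [v|v|v].
    exact: (@differentiable_comp _ _ _ _ F G).
    by [].
  move=> Ov /=; rewrite (EF _ Ov) EG; first exact: gf.
  by apply: fST; exists v.
- suff H : F \o G =1 id by move=> v; exact: H.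
  apply: (entire_eqV kT (f := F \o G) (g := id)) => [v|v|v].
    exact: (@differentiable_comp _ _ _ _ G F).
    by [].
  move=> Ov /=; rewrite (EG _ Ov) EF; first exact: fg.
  by apply: gTS; exists v.
Qed.

(** A real step [t] along [ev R i] changes the form by [t ^+ 2] plus a term linear in [t], which is
    made nonnegative by the sign of [t]. *)
Lemma boundary_approx S i w (d : R) : i \in S -> Hf S w = 0 -> 0 < d ->
  exists2 w', rn (w' - w) < d & Om S w'.
Proof.
move=> iS w0 d0; pose s := d / (2 * (rn (ev R i) + 1)).
have e0 : 0 <= rn (ev R i) by exact: rn_ge0.
have s0 : 0 < s by rewrite divr_gt0 // mulr_gt0 // ltr_wpDl.
have sd : s * rn (ev R i) < d.
  have E : s * (rn (ev R i) + 1) * 2 = d by rewrite /s; field; lra.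
  nra.
have H (t : R) : t != 0 -> 0 <= t * cRe (hp S (ev R i) w) -> Om S (w + rc t *: ev R i).
  move=> t0 ht; 
  rewrite OmE HfD w0 add0r hpZl cReM /= mul0r subr0 Hf_ev // rn_rc.
  have q0 : 0 < `|t| ^+ 2 by rewrite exprn_gt0 // normr_gt0.
  lra.
have [h|h] := leP 0 (cRe (hp S (ev R i) w)).
  exists (w + rc s *: ev R i); last by apply: H; rewrite ?gt_eqF // mulr_ge0 // ltW.
  by rewrite addrC addKr rnZ rn_rc gtr0_norm.
exists (w + rc (- s) *: ev R i).
  by rewrite addrC addKr rnZ rn_rc normrN gtr0_norm.
by apply: H; rewrite ?oppr_eq0 ?gt_eqF // mulNr oppr_ge0 mulr_ge0_le0 // ltW.
Qed.

(* [F] permutes the complement of [Om S], hence its interior [Om (~: S)]. *)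
Lemma preserve_compl S F G : has_pair S -> entire G -> cancel F G ->
  (forall v, Om S v -> Om S (G v)) ->
  forall v, Om (~: S) v -> Om (~: S) (F v).
Proof.
move=> [i [_ [iS _ _]]] dG FG GS v; rewrite !OmE !Hf_setC !oppr_gt0 => Hv.
have nOm w : Hf S (G w) < 0 -> ~ Om S w.
  by move=> h /GS; rewrite OmE; lra.
have := nOm (F v); rewrite FG => /(_ Hv); rewrite OmE => /negP; rewrite -leNgt.
rewrite le_eqVlt => /orP[/eqP E|//]; exfalso.
(* If [F v] were on the null cone, points of [Om S] close to it would be sent by [G] close to [v],
   where the form is negative. *)
have cG : Hf S (G w) @[w --> F v] --> Hf S v.
  rewrite -{2}(FG v); apply: (@continuous_comp _ _ _ G (@Hf R n S)).
    exact: differentiable_continuous.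
  exact: continuous_Hf.
have /nbhs_rnP[d d0 K] : \forall w \near F v, Hf S (G w) < 0 by move/cvgr_lt: cG; exact.
have [w' w'd] := boundary_approx iS E d0.
exact/nOm/K.
Qed.

(** [phi] chooses the entire extension of an automorphism. Since entire maps are determined on
    either cone, each group law may be checked on whichever cone is convenient. *)
Lemma aut_isomorphic_compl S : has_pair S -> has_pair (~: S) ->
  aut_isomorphic (Om S) (Om (~: S)).
Proof.
move=> pS pC; have [i [j [iS jS ij]]] := pS; have [k [l [kS lS kl]]] := pC.
pose ext_of f F := [/\ entire F, is_aut (Om S) F, is_aut (Om (~: S)) F & forall v, Om S v -> F
  v = f v].
have eS F G : entire F -> entire G -> (forall v, Om S v -> F v = G v) -> F =1 G.
  exact: (entire_eqV iS).
have eC F G : entire F -> entire G -> (forall v, Om (~: S) v -> F v = G v) -> F =1 G.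
  exact: (entire_eqV kS).
have key T f : has_pair T -> is_aut (Om T) f -> exists F,
    [/\ entire F, is_aut (Om T) F, is_aut (Om (~: T)) F & forall v, Om T v -> F v = f v].
  move=> pT [g fg]; have [F [G [dF dG FG GF [EF EG]]]] := biholo_entire pT pT fg.
  have [_ _ fT gT _] := fg.
  have FT v : Om T v -> Om T (F v) by move=> Ov; rewrite EF //; apply: fT; exists v.
  have GT v : Om T v -> Om T (G v) by move=> Ov; rewrite EG //; apply: gT; exists v.
  exists F; split=> //; first exact: entire_aut FT GT.
  apply: (entire_aut dF dG FG GF); first exact: preserve_compl GT.
  exact: preserve_compl FT.
have /choice[phi Hphi] : forall f, exists F, is_aut (Om S) f -> ext_of f F.
  move=> f; have [/(key S f pS)[F HF]|nf] := pselect (is_aut (Om S) f).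
    by exists F.
  by exists f.
exists phi; split.
- by move=> f /Hphi[].
- move=> f g fA gA; have [dF _ _ EF] := Hphi f fA; have [dG _ _ EG] := Hphi g gA.
  split=> H v Ov; first by rewrite -EF // -EG // (eC _ _ dF dG H).
  by apply: (eS _ _ dF dG) => w Ow; rewrite EF // EG //; exact: H.
- move=> f g fA gA v _; have [dF _ _ EF] := Hphi f fA; have [dG _ _ EG] := Hphi g gA.
  have [dFG _ _ EFG] := Hphi _ (is_aut_comp fA gA).
  have dFG' : entire (phi f \o phi g).
    by move=> w; apply: (@differentiable_comp _ _ _ _ (phi g) (phi f)).
  apply: (eS _ _ dFG dFG') => w Ow; rewrite EFG //= EG // EF //.
  by have [g' [_ _ + _ _]] := gA; apply; exists w.
- move=> h /(key _ h pC)[H [dH HC]]; rewrite finset.setCK => HS EH.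
  exists H => // v Ov; have [dF _ _ EF] := Hphi H HS.
  by rewrite -EH // (eS _ _ dF dH).
Qed.

Lemma Hf_line S (a x : V) (t : R) : Hf S (a + rc t *: x) =
  Hf S a + t * (2 * cRe (hp S x a) + t * Hf S x).
Proof.
rewrite HfD hpZl cReM HfZ rn_rc real_normK ?num_real // /cIm /= mul0r subr0.
by rewrite /cRe /=; ring.
Qed.

Lemma diff_dir F (a z : V) : differentiable F a ->
  (rc t)^-1 *: (F (rc t *: z + a) - F a) @[t --> (0 : R)^'+] --> ('d F a z : V).
Proof.
move=> dF; apply/cvg_rnP => e e0.
have z0 : 0 < rn z + 1 by rewrite ltr_wpDl // rn_ge0.
have e'0 : 0 < e / 2 / (rn z + 1) by rewrite !divr_gt0.
have [d d0 K] := diff_rnP dF e'0.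
have dz0 : 0 < d / (rn z + 1) by rewrite divr_gt0.
near=> t.
have t0 : 0 < t by near: t; exact: nbhs_right_gt.
have td : t < d / (rn z + 1) by near: t; exact: nbhs_right_lt.
have rt : rn (rc t : C) = t by rewrite rn_rc gtr0_norm.
have tC : (rc t : C) != 0 by rewrite rc_eq0 gt_eqF.
have k1 : rn (rc t *: z) < d.
  rewrite rnZ rt; apply: le_lt_trans (_ : t * (rn z + 1) < d); last by rewrite -ltr_pdivlMr.
  by rewrite ler_wpM2l ?(ltW t0) // lerDl.
have := K _ k1; rewrite linearZ /= rnZ rt => H.
have -> : (rc t)^-1 *: (F (rc t *: z + a) - F a) - 'd F a z =
    (rc t)^-1 *: (F (rc t *: z + a) - F a - rc t *: 'd F a z).
  by rewrite [RHS]scalerBr scalerA mulVf // scale1r.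
rewrite rnZ rnV rt mulrC ltr_pdivrMr //; apply: le_lt_trans H _.
rewrite mulrCA mulrC ltr_pM2r //.
have -> : e / 2 / (rn z + 1) * rn z = e / 2 * (rn z / (rn z + 1)) by ring.
apply: (@le_lt_trans _ _ (e / 2 * 1)); last by lra.
by rewrite ler_wpM2l ?divr_ge0 ?(ltW e0) // ler_pdivrMr // mul1r lerDl.
Unshelve. all: by end_near. Qed.

Lemma continuous_cRe_hp S (a : V) : continuous (fun x : V => cRe (hp S x a)).
Proof.
move=> x; apply: (@continuous_comp _ _ _ (fun x : V => hp S x a) (@cRe R)).
  by apply: differentiable_continuous; exact: differentiable_hp.
exact: continuous_Re.
Qed.

Lemma cvg_continuous_comp (h : V -> R) (u : R -> V) (l : V) (X : set_system R)
  {FX : Filter X} :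
  continuous h -> u t @[t --> X] --> l -> h (u t) @[t --> X] --> h l.
Proof. by move=> ch ul; apply: cvg_comp; [exact: ul|exact: ch]. Qed.

Lemma diff_cancel F G (b z : V) : entire F -> entire G -> cancel F G ->
  'd G (F b) ('d F b z) = z.
Proof.
move=> dF dG FG.
have E y : y = 'd G (F b) ('d F b z) -> 'd (G \o F) b z = y.
  by move=> Ey; rewrite diff_comp; [rewrite Ey|exact: dF|exact: dG].
rewrite -(E _ erefl) (_ : G \o F = id); first by rewrite diff_val.
by apply/funext => v; exact: FG.
Qed.

(** * First-order behaviour of a biholomorphism at the origin *)

Section NotBiholo.
Variables (S T : {set 'I_n}) (F G : V -> V).
Hypotheses (pS : has_pair S) (dF : entire F) (dG : entire G).
Hypotheses (FG : cancel F G) (GF : cancel G F).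
Hypotheses (FST : forall v, Om S v -> Om T (F v)).
Hypotheses (GTS : forall v, Om T v -> Om S (G v)).

Let a := F 0.
Let A (z : V) : V := 'd F 0 z.
Let q (z : V) (t : R) : V := (rc t)^-1 *: (F (rc t *: z) - a).

Let qA z : q z t @[t --> (0 : R)^'+] --> A z.
Proof.
have := @diff_dir F 0 z (dF 0); rewrite /q /a.
by under eq_fun do rewrite addr0.
Qed.

Let Fq z (t : R) : 0 < t -> F (rc t *: z) = a + rc t *: q z t.
Proof.
move=> t0; rewrite /q scalerA mulfV ?scale1r; first by rewrite addrC subrK.
by rewrite rc_eq0 gt_eqF.
Qed.

Let scale_Om U (t : R) z : 0 < t -> Om U z -> Om U (rc t *: z).
Proof. by move=> t0; rewrite !OmE HfZ rn_rc => h;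
  rewrite mulr_gt0 // exprn_gt0 // normr_gt0 gt_eqF. Qed.

Let cvg_HfA z : Hf T (q z t) @[t --> (0 : R)^'+] --> Hf T (A z).
Proof. exact: (cvg_continuous_comp (@continuous_Hf R n T) (@qA z)). Qed.

Let id0 : t @[t --> (0 : R)^'+] --> (0 : R).
Proof. by apply: cvg_at_right_filter; exact: cvg_id. Qed.

(** [a] is a limit of points [F (rc t *: ev R i)] of [Om T], but is not in [Om T] itself, as [G]
    would put 0 into [Om S]. *)
Let Hfa : Hf T a = 0.
Proof.
have [i [_ [iS _ _]]] := pS.
have Oe : Om S (ev R i) by rewrite -(scale1r (ev R i)); apply: Om_ev => //; exact: oner_neq0.
apply/eqP; rewrite eq_le; apply/andP; split.
  rewrite leNgt; apply/negP => /GTS; rewrite FG OmE.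
  by rewrite -(scale0r (ev R i)) HfZ rn0 expr0n mul0r ltxx.
have lim : Hf T a + t * (2 * cRe (hp T (q (ev R i) t) a) + t * Hf T (q (ev R i) t)) @[t --> (0
  : R)^'+]
    --> Hf T a + 0 * (2 * cRe (hp T (A (ev R i)) a) + 0 * Hf T (A (ev R i))).
  apply: cvgD; first exact: cvg_cst.
  apply: cvgM; first exact: id0.
  apply: cvgD; last by apply: cvgM; [exact: id0|exact: cvg_HfA].
  apply: cvgM; first exact: cvg_cst.
  exact: (cvg_continuous_comp (@continuous_cRe_hp T a) (@qA _)).
rewrite -[Hf T a]addr0 -[X in _ + X](mul0r (2 * cRe (hp T (A (ev R i)) a) + 0 * Hf T (A (ev R
  i)))).
apply: (cvgr_to_ge lim); near=> t.
have t0 : 0 < t by near: t; exact: nbhs_right_gt.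
rewrite -Hf_line -Fq //; apply: ltW; exact/FST/scale_Om.
Unshelve. all: by end_near. Qed.

Let slope_pos z (t : R) : 0 < t -> Om S z -> 0 < 2 * cRe (hp T (q z t) a) + t * Hf T (q z t).
Proof.
move=> t0 /(scale_Om t0) /FST; rewrite OmE Fq // Hf_line Hfa add0r.
by rewrite pmulr_rgt0.
Qed.

Let re_ge0 z : Om S z -> 0 <= cRe (hp T (A z) a).
Proof.
move=> Oz.
have lim : 2 * cRe (hp T (q z t) a) + t * Hf T (q z t) @[t --> (0 : R)^'+]
    --> 2 * cRe (hp T (A z) a) + 0 * Hf T (A z).
  apply: cvgD; last by apply: cvgM; [exact: id0|exact: cvg_HfA].
  apply: cvgM; first exact: cvg_cst.
  exact: (cvg_continuous_comp (@continuous_cRe_hp T a) (@qA _)).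
suff : 0 <= 2 * cRe (hp T (A z) a) + 0 * Hf T (A z) by rewrite mul0r addr0 pmulr_rge0.
apply: (cvgr_to_ge lim); near=> t.
have t0 : 0 < t by near: t; exact: nbhs_right_gt.
exact/ltW/slope_pos.
Unshelve. all: by end_near. Qed.

Let AZ (c : C) z : A (c *: z) = c *: A z.
Proof. by rewrite /A linearZ. Qed.

Let OmZ (c : C) z : c != 0 -> Om S z -> Om S (c *: z).
Proof. by move=> c0; rewrite !OmE HfZ => h; rewrite mulr_gt0 // exprn_gt0 // rn_gt0. Qed.

(** The inequality [re_ge0], applied to the multiples of [z] by 1, -1, i and -i, annihilates both
    real and imaginary part. *)
Let hp_Om z : Om S z -> hp T (A z) a = 0.
Proof.
move=> Oz.
have ge0 (c : C) : c != 0 -> 0 <= cRe (c * hp T (A z) a).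
  by move=> c0; rewrite -hpZl -AZ; exact/re_ge0/OmZ.
have i0 : ic R != 0 by rewrite -rn_gt0 rn_ic.
have h1 := ge0 1 (oner_neq0 _).
have h2 : 0 <= cRe (- 1 * hp T (A z) a) by apply: ge0; rewrite oppr_eq0 oner_eq0.
have h3 := ge0 (ic R) i0.
have h4 : 0 <= cRe (- ic R * hp T (A z) a) by apply: ge0; rewrite oppr_eq0.
move: h1 h2 h3 h4; rewrite mul1r mulN1r mulNr !cReN cReM /= mul0r mul1r sub0r.
by move=> h1 h2 h3 h4; apply: Cext; rewrite /=; lra.
Qed.

Let B (z : V) : V := 'd G a z.

Let BA z : B (A z) = z.
Proof. exact: diff_cancel. Qed.

Let AB z : A (B z) = z.
Proof. by rewrite /A -[X in 'd F X](FG 0); exact: diff_cancel. Qed.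

(** A large multiple of [ev R i] absorbs [x]: the square of [M] outweighs the linear term and, as
    [M >= 1], also [Hf S x]. *)
Let span x : exists y z, [/\ Om S y, Om S z & x = y - z].
Proof.
have [i [_ [iS _ _]]] := pS.
pose M : R := Num.max 1 (2 * `|cRe (hp S x (ev R i))| + `|Hf S x| + 1).
have M1 : 1 <= M by rewrite le_max lexx.
have M2 : 2 * `|cRe (hp S x (ev R i))| + `|Hf S x| + 1 <= M by rewrite le_max lexx orbT.
exists (rc M *: ev R i + x), (rc M *: ev R i); split.
- rewrite OmE HfD Hf_ev // rn_rc real_normK ?num_real // hpZr cj_rc cReM.
  have -> : cRe (rc M : C) = M by []. have -> : cIm (rc M : C) = 0 by [].
  rewrite mul0r subr0.
  have e1 := ler_norm (- cRe (hp S x (ev R i))); rewrite normrN in e1.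
  have e2 := ler_norm (- Hf S x); rewrite normrN in e2.
  have n1 := normr_ge0 (cRe (hp S x (ev R i))); have n2 := normr_ge0 (Hf S x).
  set p := cRe _ in M2 e1 n1 *; set s := Hf S x in M2 e2 n2 *.
  set P := `|p| in M2 e1 n1; set Q := `|s| in M2 e2 n2.
  have h1 : - (M * P) <= M * p by nra.
  have h2 : Q <= M * Q by nra.
  nra.
- by rewrite OmE Hf_ev // rn_rc exprn_gt0 // normr_gt0; lra.
- by rewrite addrC addKr.
Qed.

(* If [a] were a nonzero point of the null cone, [Om S] would be mapped infinitesimally
   to one side of its tangent hyperplane; but [Om S] is stable under all scalars. *)
Let a0 : a = 0.
Proof.
have hp_all z : hp T (A z) a = 0.
  have [y [w [Oy Ow ->]]] := span z.
  have -> : A (y - w) = A y - A w by rewrite /A linearB.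
  by rewrite hpDl hpNl !hp_Om // subrr.
apply: coP => k; rewrite co0.
have := hp_all (B (ev R k)); rewrite AB /hp (bigD1 k) //= big1 => [|l lk].
  rewrite co_ev eqxx mulr1 addr0 => /eqP; rewrite mulf_eq0 cj_eq0 rc_eq0.
  case/orP => [|/eqP //]; rewrite /sg; case: ifP => _; rewrite ?oppr_eq0 oner_eq0 //.
by rewrite co_ev (negbTE lk) mulr0 mul0r.
Qed.

(** With [a = 0] the linear term of [slope_pos] disappears, and the quadratic one passes to the
    limit as a weak inequality. *)
Let HfA_ge0 z : Om S z -> 0 <= Hf T (A z).
Proof.
move=> Oz; apply: (cvgr_to_ge (@cvg_HfA z)); near=> t.
have t0 : 0 < t by near: t; exact: nbhs_right_gt.
have E : cRe (hp T (q z t) a) = 0.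
  have cj0 : cj (0 : C) = 0 by apply/eqP; rewrite cj_eq0.
  by rewrite a0 -(scale0r (0 : V)) hpZr cj0 mul0r.
have := slope_pos t0 Oz; rewrite E mulr0 add0r pmulr_rgt0 //; exact: ltW.
Unshelve. all: by end_near. Qed.

(* [A] would map the span of the [ev k], [k in S], into the closure of [Om T], while
   some nonzero vector of this span has an image with vanishing [T]-coordinates. *)
Lemma card_le_of_biholo : (#|S| <= #|T|)%N.
Proof.
rewrite leqNgt; apply/negP => TS.
(* [M] takes the coefficients of a combination of the [ev k], [k] in [S], to the [T]-coordinates of
   its image under [A]; having more rows than columns, it kills some nonzero row. *)
pose M : 'M[C]_(#|S|, #|T|) := \matrix_(p, r) co (A (ev R (enum_val p))) (enum_val r).
have : kermx M != 0.
  rewrite kermx_eq0 /row_free; apply: contraTneq TS => <-.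
  by rewrite -leqNgt rank_leq_col.
case/rowV0Pn => x /sub_kermxP xM x0.
pose z : V := \sum_p x ord0 p *: ev R (enum_val p).
have Az k : co (A z) k = \sum_p x ord0 p * co (A (ev R (enum_val p))) k.
  rewrite /z /A linear_sum /co summxE; apply: eq_bigr => p _.
  by rewrite linearZ mxE.
have cz k : co z k = \sum_p x ord0 p * (k == enum_val p)%:R.
  by rewrite /z {1}/co summxE; apply: eq_bigr => p _; rewrite -[LHS]/(co _ k) coZ co_ev.
have [p xp] : exists p, x ord0 p != 0.
  apply: contrapT => H; move/negP: x0; apply; apply/eqP/rowP => p; rewrite mxE.
  by apply/eqP/negPn/negP => xp; apply: H; exists p.
have zp : co z (enum_val p) = x ord0 p.
  rewrite cz (bigD1 p) //= eqxx mulr1 big1 ?addr0 // => r rp.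
  by rewrite (inj_eq enum_val_inj) eq_sym (negbTE rp) mulr0.
have Oz : Om S z.
  apply: (@Om_supp R n S z (enum_val p)) => [k kS|]; last by rewrite zp.
  rewrite cz big1 // => r _; case: eqP => [E|_]; last by rewrite mulr0.
  by move: kS; rewrite E enum_valP.
have AzT k : k \in T -> co (A z) k = 0.
  move=> kT; rewrite Az; move/rowP: xM => /(_ (enum_rank_in kT k)).
  rewrite !mxE => E; rewrite -[RHS]E; apply: eq_bigr => r _.
  by rewrite mxE enum_rankK_in.
have AzC : \sum_(k in ~: T) rn (co (A z) k) ^+ 2 <= 0.
  have := HfA_ge0 Oz; rewrite Hf_split big1 => [|k kT]; last by rewrite AzT // rn0 expr0n.
  by rewrite sub0r oppr_ge0.
have Az0 : A z = 0.
  apply: coP => k; rewrite co0; have [/AzT //|kT] := boolP (k \in T).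
  apply/eqP; rewrite -rn_eq0 -sqrf_eq0 eq_le sqr_ge0 andbT.
  apply: le_trans AzC; rewrite (bigD1 k) ?inE //= lerDl.
  by apply: sumr_ge0 => l _; exact: sqr_ge0.
have z0 : z = 0 by rewrite -(BA z) Az0 /B linear0.
by move: xp; rewrite -zp z0 co0 eqxx.
Qed.

End NotBiholo.
End Iso.

Section Main.
Variables (R : realType) (n : nat).

Lemma not_biholomorphic (S T : {set 'I_n}) : has_pair S -> has_pair T ->
  (#|T| < #|S|)%N -> ~ biholomorphic (@Om R n S) (Om T).
Proof.
move=> pS pT TS [f [g fg]].
have [F [G [dF dG FG GF [EF EG]]]] := biholo_entire pS pT fg.
have [_ _ fST gTS _] := fg.
have FST v : Om S v -> Om T (F v) by move=> Ov; rewrite EF //; apply: fST; exists v.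
have GTS v : Om T v -> Om S (G v) by move=> Ov; rewrite EG //; apply: gTS; exists v.
have := card_le_of_biholo pS dF dG FG GF FST GTS.
by rewrite leqNgt TS.
Qed.

End Main.

Local Close Scope ring_scope.
Local Close Scope complex_scope.

Theorem theorem6p1 (R : realType) (n : nat) : (5 <= n)%N ->
  exists Omega1 Omega2 : set (Cn R n),
    [/\ is_domain Omega1 /\ is_domain Omega2,
        ~ bounded_set Omega1 /\ ~ bounded_set Omega2,
        homogeneous Omega1 /\ homogeneous Omega2,
        ~ biholomorphic Omega1 Omega2 &
        aut_isomorphic Omega1 Omega2].
Proof.
move=> n5.
have [n0 n1 n2 n3] : [/\ 0 < n, 1 < n, 2 < n & 3 < n]%N.
  by split; apply: leq_trans n5.
pose o k (h : (k < n)%N) : 'I_n := Ordinal h.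
(* Two indices against the [n - 2 >= 3] others: each side has a pair, and the cardinals differ. *)
pose T : {set 'I_n} := [set o _ n0; o _ n1]%SET.
have oE k l (h : (k < n)%N) (h' : (l < n)%N) : (o k h == o l h') = (k == l) by [].
have cT : #|T| = 2%N by rewrite cards2 oE.
have pC : has_pair (~: (~: T)).
  by exists (o _ n0), (o _ n1); rewrite finset.setCK !inE !oE.
have pS : has_pair (~: T).
  by exists (o _ n2), (o _ n3); rewrite !inE !oE.
have [i [j [iS jS ij]]] := pS; have [k [l [kC lC kl]]] := pC.
(* The larger index set comes first, as [not_biholomorphic] requires; the smaller one stays a double
   complement, the shape in which [aut_isomorphic_compl] delivers it. *)
exists (Om (~: T)), (Om (~: (~: T))); split.
- by split; [exact: domain_Om ij|exact: domain_Om kl].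
- by split; [exact: unbounded_Om iS|exact: unbounded_Om kC].
- by split; exact: homogeneous_Om.
- apply: not_biholomorphic => //; rewrite finset.setCK cT.
  by rewrite cardsCs finset.setCK cT card_ord ltn_subRL; exact: leq_trans n5.
- exact: aut_isomorphic_compl.
Qed.
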